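(* Let $u=v_0<v_1<v_2<\dots<v_\ell=w$ be a maximal chain from $u$ to $w$ in the Bruhat order on $S_k$. Then there is an open embedding $$(\mathbb{C}^\times)^\ell\simeq R(v_0,v_1)\times R(v_1,v_2)\times\cdots\times R(v_{\ell-1},v_\ell)\hookrightarrow R(u,w).$$
   Context: $S_k$ is the symmetric group, $w_0$ its longest element. For $w\in S_k$ the coordinate flag $\mathcal{F}(w)$ in $\mathbb{C}^k$ has $j$-th subspace spanned by $e_{w(1)},\dots,e_{w(j)}$; $\mathcal{F}^{\mathrm{std}}=\mathcal{F}(e)$ and $\mathcal{F}^{\mathrm{ant}}=\mathcal{F}(w_0)$. For complete flags write $\mathcal{F}\xrightarrow{w}\mathcal{F}'$ if there is $g\in\mathrm{GL}(k)$ with $g\mathcal{F}=\mathcal{F}^{\mathrm{std}}$ and $g\mathcal{F}'=\mathcal{F}(w)$. For $v\le w$ in Bruhat order, the open Richardson variety is $$R(v,w)=\{\mathcal{F}\in\mathrm{Fl}_k\mid \mathcal{F}^{\mathrm{std}}\xrightarrow{w}\mathcal{F}\xrightarrow{v^{-1}w_0}\mathcal{F}^{\mathrm{ant}}\},$$ where $\mathrm{Fl}_k$ is the variety of complete flags in $\mathbb{C}^k$. A maximal chain from $u$ to $w$ is one in which each $v_i$ covers $v_{i-1}$ in Bruhat order. *)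

(* Defs.v *)
From HB Require Import structures.
From mathcomp Require Import all_boot all_order all_fingroup all_algebra.
From mathcomp Require Import classical_sets reals complex.

Set Implicit Arguments.
Unset Strict Implicit.
Unset Printing Implicit Defensive.

Import GRing.Theory.
Local Open Scope ring_scope.

(** * The symmetric group and its Bruhat order *)

Definition perm_length (k : nat) (w : 'S_k) : nat :=
  #|[set p : 'I_k * 'I_k | (p.1 < p.2)%N && (w p.2 < w p.1)%N]|.

Definition longest_perm (k : nat) : 'S_k := perm (@rev_ord_inj k).

Lemma leq_length_longest (k : nat) (w : 'S_k) :
  (perm_length w <= perm_length (longest_perm k))%N.
Proof.
apply/subset_leq_card/fintype.subsetP => -[i j]; rewrite !inE /= !permE /=.
by case/andP=> lt_ij _; rewrite lt_ij ltn_sub2l // (leq_ltn_trans lt_ij).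
Qed.

Definition bruhat_step (k : nat) : rel 'S_k := fun v w =>
  [exists i, exists j, w == (tperm i j * v)%g]
  && (perm_length v < perm_length w)%N.

Definition bruhat_le (k : nat) : rel 'S_k := connect (@bruhat_step k).

Definition bruhat_lt (k : nat) : rel 'S_k := fun v w =>
  (v != w) && bruhat_le v w.

(* w covers v *)
Definition bruhat_cover (k : nat) : rel 'S_k := fun v w =>
  bruhat_lt v w && [forall z, ~~ (bruhat_lt v z && bruhat_lt z w)].

Local Open Scope classical_set_scope.

(** * Spaces with functions *)

(* Varieties are handled as spaces with functions: a set of closed points, its
   Zariski topology, and its regular functions.  [regular U f] says that the
   restriction of [f] to the open set [U] is regular; the values of [f] outside
   [U] are irrelevant.  The sheaf axioms are not part of the record: every
   space below is obtained by the explicit constructions that follow. *)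
Record fspace (C : fieldType) := FSpace {
  point :> Type;
  zopen : set (set point);
  regular : set point -> set (point -> C) }.

Inductive generated_algebra (C : fieldType) (T : Type) (G : set (T -> C)) :
    (T -> C) -> Prop :=
  | GenIn f of G f : generated_algebra G f
  | GenConst (c : C) : generated_algebra G (fun=> c)
  | GenAdd f g of generated_algebra G f & generated_algebra G g :
      generated_algebra G (fun x => f x + g x)
  | GenMul f g of generated_algebra G f & generated_algebra G g :
      generated_algebra G (fun x => f x * g x).

(* [chart V G] declares that V is open and that the functions of G are regular
   on V.  The topology has the sets {y in V | q y != 0} as a basis, and the
   regular functions are locally the fractions p / q, with p and q in the
   algebra generated by G, for some [chart V G]. *)
Definition chart_space (C : fieldType) (T : Type)
    (chart : set T -> set (T -> C) -> Prop) : fspace C :=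
  @FSpace C T
    (fun U => forall x, U x -> exists V G q,
       [/\ chart V G, generated_algebra G q, V x, q x != 0
         & forall y, V y -> q y != 0 -> U y])
    (fun U f => forall x, U x -> exists V G p q,
       [/\ chart V G, generated_algebra G p, generated_algebra G q,
           V x /\ q x != 0
         & forall y, U y -> V y -> q y != 0 -> f y = p y / q y]).

Definition affine_line (C : fieldType) : fspace C :=
  chart_space (fun (V : set C) (G : set (C -> C)) =>
    V = setT /\ G = [set id]).

Definition matrix_space (C : fieldType) (m n : nat) : fspace C :=
  chart_space (fun (V : set 'M[C]_(m, n)) (G : set ('M[C]_(m, n) -> C)) =>
    V = setT /\ G = [set f | exists i j, f = (fun A : 'M_(m, n) => A i j)]).

(* A locally closed subset with its reduced induced structure. *)
Definition subspace (C : fieldType) (X : fspace C) (A : set X) : fspace C :=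
  @FSpace C {x : X | A x}
    (fun U => exists2 V : set X, zopen V & U = sval @^-1` V)
    (fun U f => forall x, U x -> exists (V : set X) (h : X -> C),
       [/\ zopen V, regular V h, V (sval x)
         & forall y, U y -> V (sval y) -> f y = h (sval y)]).

Definition quotient_space (C : fieldType) (X : fspace C) (T : Type)
    (pi : X -> T) : fspace C :=
  @FSpace C T
    (fun U => zopen (pi @^-1` U))
    (fun U f => regular (pi @^-1` U) (f \o pi)).

(* The product of varieties, which carries a finer topology than the product
   topology: on a box of open sets U i, the functions h (x i) with h regular
   on U i generate the structure. *)
Definition product_space (C : fieldType) (I : finType) (X : I -> fspace C) :
    fspace C :=
  @chart_space C (forall i, X i) (fun V G =>
    exists2 U : forall i, set (X i), (forall i, zopen (U i))
    & V = [set x | forall i, U i (x i)] /\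
      G = [set f | exists i (h : X i -> C),
                   regular (U i) h /\ f = (fun x => h (x i))]).

Definition is_morphism (C : fieldType) (X Y : fspace C) (f : X -> Y) : Prop :=
  (forall V : set Y, zopen V -> zopen (f @^-1` V)) /\
  (forall (V : set Y) (h : Y -> C), zopen V -> regular V h ->
     regular (f @^-1` V) (h \o f)).

Definition is_isomorphism (C : fieldType) (X Y : fspace C) (f : X -> Y) : Prop :=
  is_morphism f /\
  exists g : Y -> X, [/\ is_morphism g, cancel f g & cancel g f].

Definition is_open_embedding (C : fieldType) (X Y : fspace C) (f : X -> Y) :
    Prop :=
  exists (U : set Y) (g : X -> subspace U),
    [/\ zopen U, is_isomorphism g & forall x, f x = sval (g x)].

Definition torus (C : fieldType) (l : nat) : fspace C :=
  product_space (fun _ : 'I_l =>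
    @subspace C (affine_line C) [set x | x != 0]).

(** * Complete flags *)

Definition is_flag (C : fieldType) (k : nat)
    (F : {ffun 'I_k.+1 -> {vspace 'cV[C]_k}}) : bool :=
  [forall j : 'I_k.+1, \dim (F j) == j]
  && [forall i : 'I_k.+1, forall j : 'I_k.+1, (i <= j)%N ==> (F i <= F j)%VS].

Record flag (C : fieldType) (k : nat) := Flag {
  flag_sub :> {ffun 'I_k.+1 -> {vspace 'cV[C]_k}};
  flagP : is_flag flag_sub }.

Lemma basis_flag_proof (C : fieldType) (k : nat) (b : k.-tuple 'cV[C]_k) :
  free b -> is_flag [ffun j : 'I_k.+1 => <<take j b>>%VS].
Proof.
move=> fb; apply/andP; split.
  apply/forallP=> j; rewrite ffunE.
  have ft : free (take j b) by apply: (@catl_free _ _ (drop j b)); rewrite cat_take_drop.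
  by move: ft; rewrite /free => /eqP->; rewrite size_takel // size_tuple -ltnS.
apply/forallP=> i; apply/forallP=> j; apply/implyP=> le_ij; rewrite !ffunE.
by apply: sub_span => x; rewrite -(take_takel _ le_ij); apply: mem_take.
Qed.

(* The flag whose j-th subspace is spanned by the first j vectors of b. *)
Definition basis_flag (C : fieldType) (k : nat) (b : k.-tuple 'cV[C]_k)
    (fb : free b) : flag C k :=
  Flag (basis_flag_proof fb).

Definition GL_space (C : fieldType) (k : nat) : fspace C :=
  @subspace C (matrix_space C k k) [set g | g \in unitmx].

Lemma columns_free (C : fieldType) (k : nat) (g : 'M[C]_k) :
  g \in unitmx -> free [tuple col i g | i < k].
Proof.
move=> ug; apply/freeP => c.
under eq_bigr => i _ do rewrite -tnth_nth tnth_mktuple.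
move=> c0 i.
have gc0 : g *m (\col_j c j) = 0.
  rewrite -c0; apply/colP => m; rewrite mxE summxE.
  by apply: eq_bigr => j _; rewrite !mxE mulrC.
have /colP/(_ i) : \col_j c j = 0 by rewrite -(mulKmx ug (\col_j c j)) gc0 mulmx0.
by rewrite !mxE.
Qed.

Definition flag_of_GL (C : fieldType) (k : nat) (g : GL_space C k) : flag C k :=
  basis_flag (columns_free (svalP g)).

(* Fl_k, as the quotient of GL(k) by the stabilizer of the standard flag. *)
Definition flag_space (C : fieldType) (k : nat) : fspace C :=
  quotient_space (@flag_of_GL C k).

Lemma coord_basis_free (C : fieldType) (k : nat) (w : 'S_k) :
  free [tuple (delta_mx (w i) 0 : 'cV[C]_k) | i < k].
Proof.
have := columns_free (unitmx_perm C (w^-1)%g).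
congr (free (tval _)); apply: eq_mktuple => i.
apply/colP => j; rewrite !mxE eqxx andbT.
by rewrite -(inj_eq (@perm_inj _ w)) permKV.
Qed.

Definition coord_flag (C : fieldType) (k : nat) (w : 'S_k) : flag C k :=
  basis_flag (coord_basis_free C w).

Definition std_flag (C : fieldType) (k : nat) : flag C k :=
  coord_flag C (1 : 'S_k)%g.

Definition ant_flag (C : fieldType) (k : nat) : flag C k :=
  coord_flag C (longest_perm k).

Lemma flag_act_proof (C : fieldType) (k : nat) (g : GL_space C k) (F : flag C k) :
  is_flag [ffun j => (linfun (mulmx (sval g) : 'cV_k -> 'cV_k) @: F j)%VS].
Proof.
have /andP[/forallP dF /forallP sF] := flagP F.
apply/andP; split.
  apply/forallP=> j; rewrite ffunE limg_dim_eq ?dF //.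
  have /eqP -> : lker (linfun (mulmx (sval g) : 'cV_k -> 'cV_k)) == 0%VS.
    apply/lker0P => x y; rewrite !lfunE /=; exact: (can_inj (mulKmx (svalP g))).
  exact: capv0.
apply/forallP=> i; apply/forallP=> j; apply/implyP=> le_ij; rewrite !ffunE.
by apply: limgS; move/forallP: (sF i) => /(_ j); rewrite le_ij.
Qed.

Definition flag_act (C : fieldType) (k : nat) (g : GL_space C k) (F : flag C k) :
    flag C k :=
  Flag (flag_act_proof g F).

Definition relative_position (C : fieldType) (k : nat) (F : flag C k) (w : 'S_k)
    (F' : flag C k) : Prop :=
  exists g : GL_space C k,
    flag_act g F = std_flag C k /\ flag_act g F' = coord_flag C w.

(** * Open Richardson varieties *)

(* The product of permutations in the library is (s * t) x = t (s x), so the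
   composite of functions v^-1 o w_0 is written w_0 * v^-1. *)
Definition richardson (C : fieldType) (k : nat) (v w : 'S_k) : fspace C :=
  @subspace C (flag_space C k) [set F |
    relative_position (std_flag C k) w F /\
    relative_position F (longest_perm k * v^-1)%g (ant_flag C k)].

(* Main.v *)
Require Import Defs.
From HB Require Import structures.
From mathcomp Require Import all_boot all_order all_fingroup all_algebra.
From mathcomp Require Import classical_sets reals complex.
From mathcomp Require Import boolp zify.

Set Implicit Arguments.
Unset Strict Implicit.
Unset Printing Implicit Defensive.

Import GRing.Theory.
Local Open Scope ring_scope.

(** The heart of the matter is a splicing map: for permutations [u], [v], [w],
    the part of R(u,w) that lies in the chart vB_-B/B is isomorphic to
    R(u,v) x R(v,w).  The chart is parametrized by g |-> gvB with g in the
    unipotent group vU_-v^-1, and every such g factors in two ways,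

      g = n b = n' a,   n, a in U_-,   n', b in U,

    with all factors again in vU_-v^-1.  Since BwB is stable under U on the
    left and B_-uB under U_-, the point gvB lies in R(u,w) exactly when bvB lies
    in B_-uB and avB lies in BwB, that is, when bvB is in R(u,v) and avB is in
    R(v,w).  Conversely (b, a) determines g: the LU factorization b a^-1 = L b'
    gives g = L^-1 b = b' a.  All these factors are LU factors, hence rational
    functions of the matrix entries whose denominators are leading principal
    minors, and the minors in question are 1 on vU_-v^-1.  So the maps in both
    directions are morphisms ([splice_open_emb]).  Splicing off the last step of
    the chain embeds the product of the R(v_i, v_{i+1}) into R(u, v_l) by
    induction on the length ([chain_open_emb]).

    For a cover w = v o (i j) the variety R(v,w) is the curve
    s |-> (1 + s E_{v(j),v(i)}) vB with s invertible ([cover_isomorphism]).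
    That these flags lie in R(v,w) is a computation in SL_2.  That there are no
    others comes from ranks ([cover_support]): a coordinate of the chart at [v]
    that is nonzero raises the rank of some corner submatrices above its value at
    [v], while on BwB only the corners in the rectangle spanned by i, j and
    v(i), v(j) may have a larger rank, and for a cover this rectangle contains no
    further point of the graph of [v].

    The geometric part is bookkeeping for spaces with functions: the universal
    property of products, and the fact that open embeddings are stable under
    composition and products. *)

(** * Covers in the Bruhat order *)

(** The map [phi] applies the transposition to both entries of a pair, except
    when this would put the pair in decreasing order; in that case the pair is
    itself an inversion of [tperm i j * v].  So [phi] injects the inversions of
    [v] into those of [tperm i j * v], and it misses [(i, j)]. *)
Lemma perm_length_tperm (k : nat) (v : 'S_k) (i j : 'I_k) :
  (i < j)%N -> (v i < v j)%N ->
  (perm_length v < perm_length (tperm i j * v)%g)%N.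
Proof.
move=> lt_ij lt_vij; set t := tperm i j.
pose flip (p : 'I_k * 'I_k) := (t p.2 < t p.1)%N.
pose phi (p : 'I_k * 'I_k) := if flip p then p else (t p.1, t p.2).
set A := [set p : 'I_k * 'I_k | (p.1 < p.2)%N && (v p.2 < v p.1)%N].
rewrite /perm_length -/A; set B := [set p : 'I_k * 'I_k | _].
have phiK : {in A, forall p, flip (phi p) = flip p}.
  move=> p; rewrite inE => /andP[lt_p _]; rewrite /phi; case: ifP => // _.
  by rewrite {1}/flip /= !tpermK ltnNge ltnW.
have phi_inj : {in A &, injective phi}.
  move=> p q pA qA pq; have := phiK _ pA; rewrite pq phiK // /phi => fpq.
  move: pq; rewrite /phi fpq; case: ifP => // _ [/perm_inj e1 /perm_inj e2].
  by rewrite [p]surjective_pairing e1 e2 -surjective_pairing.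
rewrite -(card_in_imset phi_inj); apply: proper_card.
apply/properP; split; last first.
  exists (i, j); first by rewrite inE /= !permM tpermL tpermR lt_ij.
  apply/imsetP => -[p pA pij]; have := phiK _ pA; rewrite -pij /flip /= tpermL tpermR.
  rewrite lt_ij => fp; move: pij; rewrite /phi /flip -fp => pij.
  by move: pA; rewrite -pij inE /= lt_ij ltnNge (ltnW lt_vij).
apply/fintype.subsetP => _ /imsetP[[a b] + ->]; rewrite inE /= => /andP[lt_ab lt_vba].
rewrite /phi /flip /=; case: ifP => [|/negbT fl]; rewrite !inE /= !permM /=; last first.
  rewrite !tpermK lt_vba andbT ltn_neqAle leqNgt fl andbT.
  by apply/eqP => /val_inj/perm_inj ab; rewrite ab ltnn in lt_ab.
rewrite lt_ab /= /t; move: lt_ab lt_vba.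
by case: tpermP => [->|->|_ _]; case: tpermP => [->|->|_ _] //=; lia.
Qed.

Lemma bruhat_stepP (k : nat) (v w : 'S_k) :
  reflect (exists i j : 'I_k, [/\ (i < j)%N, (v i < v j)%N & w = (tperm i j * v)%g])
          (bruhat_step v w).
Proof.
apply: (iffP andP) => [[/existsP[i /existsP[j /eqP ->]]]|[i [j [lt_ij lt_vij ->]]]]; last first.
  split; last exact: perm_length_tperm.
  by apply/existsP; exists i; apply/existsP; exists j.
wlog lt_ij : i j / (i < j)%N => [ih|].
  have [lt_ij|lt_ji|/val_inj ->] := ltngtP i j; first exact: ih.
    by rewrite tpermC; apply: ih.
  by rewrite tperm1 mul1g ltnn.
move=> lt_len; exists i, j; split=> //; rewrite ltnNge; apply/negP => le_vji.
have lt_vji : (v j < v i)%N.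
  by rewrite ltn_neqAle le_vji andbT (inj_eq val_inj) (inj_eq perm_inj) neq_ltn lt_ij orbT.
have := @perm_length_tperm _ (tperm i j * v)%g _ _ lt_ij.
rewrite !permM tpermL tpermR mulgA tperm2 mul1g => /(_ lt_vji).
by rewrite ltnNge ltnW.
Qed.

(** A point m between i and j whose value lies between v(i) and v(j) would
    refine [v < w] to three steps, by the transpositions (i m), (i j), (m j). *)
Lemma bruhat_coverP (k : nat) (v w : 'S_k) :
  bruhat_cover v w ->
  exists i j : 'I_k, [/\ (i < j)%N, (v i < v j)%N, w = (tperm i j * v)%g
    & forall m : 'I_k, (i < m < j)%N -> ~~ (v i < v m < v j)%N].
Proof.
move=> /andP[/andP[neq_vw /connectP[[|z s] /=]]].
  by move=> _ wv; rewrite wv eqxx in neq_vw.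
move=> /andP[vz zs] ws /forallP between.
have step_neq (x y : 'S_k) : bruhat_step x y -> x != y.
  by move=> /andP[_]; apply: contraTneq => ->; rewrite ltnn.
have no_between x : bruhat_step v x -> bruhat_le x w -> x = w.
  move=> vx xw; apply/eqP; apply: contraNT (between x) => neq_xw.
  by rewrite /bruhat_lt step_neq // neq_xw xw /bruhat_le connect1.
have zw : z = w by apply: no_between => //; apply/connectP; exists s.
rewrite zw in vz; have [i [j [lt_ij lt_vij wE]]] := bruhat_stepP _ _ vz.
exists i, j; split=> // m /andP[lt_im lt_mj]; apply/negP => /andP[lt_vim lt_vmj].
have neq_im : i != m by rewrite neq_ltn lt_im.
have neq_mj : m != j by rewrite neq_ltn lt_mj.
have neq_ij : i != j by rewrite neq_ltn lt_ij.
pose x := (tperm i m * v)%g; pose y := (tperm i j * x)%g.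
have xi : x i = v m by rewrite permM tpermL.
have xm : x m = v i by rewrite permM tpermR.
have xj : x j = v j by rewrite permM tpermD // eq_sym.
have yi : y i = v j by rewrite permM tpermL.
have ym : y m = v i by rewrite permM tpermD // eq_sym.
have yj : y j = v m by rewrite permM tpermR.
have vx : bruhat_step v x by apply/bruhat_stepP; exists i, m.
have xy : bruhat_step x y by apply/bruhat_stepP; exists i, j; rewrite xi xj.
have wy : w = (tperm m j * y)%g.
  apply/permP => a; rewrite wE permM [RHS]permM.
  case: (tpermP m j a) => [->|->|/eqP am /eqP aj].
  - by rewrite yj tpermD // eq_sym.
  - by rewrite ym tpermR.
  - case: (tpermP i j a) => [->|/eqP|/eqP ai _]; rewrite ?yi // ?(negPf aj) //.
    by rewrite permM tpermD ?permM ?tpermD // eq_sym.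
have yw : bruhat_step y w by apply/bruhat_stepP; exists m, j; rewrite ym yj.
have xw : x = w.
  by apply: no_between => //; apply: connect_trans (connect1 xy) (connect1 yw).
have := congr1 (fun p : 'S_k => p m) xw; rewrite /= xm wE permM tpermD // 1?eq_sym //.
by move=> /perm_inj im; rewrite im eqxx in neq_im.
Qed.

(** * Matrices supported on a strict order *)

Definition strict_order (k : nat) (P : rel 'I_k) : Prop :=
  irreflexive P /\ transitive P.

Definition low (k : nat) : rel 'I_k := fun x y => (y < x)%N.
Definition up (k : nat) : rel 'I_k := fun x y => (x < y)%N.

Lemma strict_low k : strict_order (@low k).
Proof. by split=> [x|y x z xy yz]; rewrite /low ?ltnn // (ltn_trans yz). Qed.

Lemma strict_up k : strict_order (@up k).
Proof. by split=> [x|y x z xy yz]; rewrite /up ?ltnn // (ltn_trans xy). Qed.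

Lemma strict_relpre k (P : rel 'I_k) (v : 'S_k) :
  strict_order P -> strict_order (relpre v P).
Proof. by move=> [irr tr]; split=> [x|y x z] /=; [exact: irr|exact: tr]. Qed.

(** A numerical function that decreases along a strict order [P]. *)
Definition height k (P : rel 'I_k) (x : 'I_k) : nat := #|[pred y | P x y]|.

Lemma height_lt k (P : rel 'I_k) x y :
  strict_order P -> P x y -> (height P y < height P x)%N.
Proof.
move=> [irr tr] Pxy; apply: proper_card; apply/properP; split.
  by apply/fintype.subsetP => z; rewrite !inE; apply: tr.
by exists y; rewrite !inE // irr.
Qed.

Definition supported (C : fieldType) k (P : rel 'I_k) (A : 'M[C]_k) : Prop :=
  forall x y, x != y -> ~~ P x y -> A x y = 0.

(** For a strict order [P] these matrices form a group.  The groups U and U_-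
    are the cases [up] and [low], and conjugating by a permutation pulls the
    order back, so all the unipotent groups needed have this form. *)
Definition unipotent (C : fieldType) k (P : rel 'I_k) (A : 'M[C]_k) : Prop :=
  forall x y, ~~ P x y -> A x y = (x == y)%:R.

Definition borel (C : fieldType) k (b : 'M[C]_k) : Prop :=
  b \in unitmx /\ supported (@up k) b.

Lemma invmx_mul (C : fieldType) k (A B : 'M[C]_k) :
  A \in unitmx -> B \in unitmx -> invmx (A *m B) = invmx B *m invmx A.
Proof.
move=> uA uB; have uAB : A *m B \in unitmx by rewrite unitmx_mul uA.
by apply: (can_inj (mulKmx uAB)); rewrite mulmxV // -mulmxA mulKVmx // mulmxV.
Qed.

(** A permutation [s] that contributes to the Leibniz formula sends each index
    to itself or to a smaller one for [P]; since it preserves the sum of the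
    heights, it is the identity. *)
Lemma det_supported (C : fieldType) k (P : rel 'I_k) (A : 'M[C]_k) :
  strict_order P -> supported P A -> \det A = \prod_x A x x.
Proof.
move=> sP supA; rewrite /determinant (bigD1 (1%g : 'S_k)) //=.
rewrite [X in _ + X]big1 => [|s s1]; last first.
  have [x xs nP] : exists2 x, x != s x & ~~ P x (s x).
    apply/exists_inP; apply: contraNT s1 => /exists_inPn noP.
    apply/eqP/permP => x; rewrite perm1; apply/eqP; case: eqP => // /eqP sx.
    have Ps y : y != s y -> P y (s y) by move=> ys; apply/negPn/noP.
    have le_h y : (height P (s y) <= height P y)%N.
      by have [<-//|/Ps/(height_lt sP)/ltnW] := eqVneq y (s y).
    have : (\sum_y height P (s y) < \sum_y height P y)%N.
      rewrite (bigD1 x) //= [ltnRHS](bigD1 x) //= -addSn leq_add //.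
        by apply/height_lt/Ps => //; rewrite eq_sym.
      by apply: leq_sum.
    by rewrite [X in (_ < X)%N](reindex_inj (@perm_inj _ s)) ltnn.
  by rewrite (bigD1 x) //= supA // mul0r mulr0.
by rewrite odd_perm1 mul1r addr0; apply: eq_bigr => x _; rewrite perm1.
Qed.

Lemma unipotent_supported (C : fieldType) k (P : rel 'I_k) (A : 'M[C]_k) :
  unipotent P A -> supported P A.
Proof. by move=> uA x y /negPf xy /uA ->; rewrite xy. Qed.

Lemma unipotent_det (C : fieldType) k (P : rel 'I_k) (A : 'M[C]_k) :
  strict_order P -> unipotent P A -> \det A = 1.
Proof.
move=> sP uA; rewrite (det_supported sP (unipotent_supported uA)) big1 // => x _.
by rewrite uA ?eqxx //; have [-> _] := sP.
Qed.

Lemma unipotent_unit (C : fieldType) k (P : rel 'I_k) (A : 'M[C]_k) :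
  strict_order P -> unipotent P A -> A \in unitmx.
Proof. by move=> sP uA; rewrite unitmxE (unipotent_det sP uA) unitr1. Qed.

Lemma unipotent1 (C : fieldType) k (P : rel 'I_k) : unipotent P (1%:M : 'M[C]_k).
Proof. by move=> x y _; rewrite mxE. Qed.

Lemma supported_mul (C : fieldType) k (P : rel 'I_k) (A B : 'M[C]_k) :
  strict_order P -> supported P A -> supported P B -> supported P (A *m B).
Proof.
move=> [_ tr] sA sB x y xy nP; rewrite mxE big1 // => z _.
have [xz|xz] := eqVneq x z; first by rewrite -xz (sB x y) ?mulr0.
have [yz|zy] := eqVneq z y; first by rewrite yz (sA x y) ?mul0r.
have [Pxz|nPxz] := boolP (P x z); last by rewrite sA ?mul0r.
by rewrite (sB z y) ?mulr0 //; apply: contraNN nP; apply: tr.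
Qed.

Lemma unipotent_mul (C : fieldType) k (P : rel 'I_k) (A B : 'M[C]_k) :
  strict_order P -> unipotent P A -> unipotent P B -> unipotent P (A *m B).
Proof.
move=> sP uA uB x y nP; have [irr tr] := sP; have [<-|xy] := eqVneq x y.
  rewrite mxE (bigD1 x) //= uA ?irr // uB ?irr // eqxx mulr1 big1 ?addr0 // => z zx.
  have [Pxz|nPxz] := boolP (P x z); last by rewrite uA // eq_sym (negPf zx) mul0r.
  rewrite (uB z x) ?(negPf zx) ?mulr0 //.
  by apply/negP => Pzx; have := tr _ _ _ Pxz Pzx; rewrite irr.
exact: (supported_mul sP (unipotent_supported uA) (unipotent_supported uB)).
Qed.

(** Row x of A^-1 is determined by its rows z with [P x z], and transitivity
    propagates the vanishing pattern; the induction is on the height of x. *)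
Lemma unipotent_inv (C : fieldType) k (P : rel 'I_k) (A : 'M[C]_k) :
  strict_order P -> unipotent P A -> unipotent P (invmx A).
Proof.
move=> sP uA x y; have [irr tr] := sP; set B := invmx A.
have [n] := ubnP (height P x); elim: n x => // n IH x ltn nP.
have Bx : B x y = (x == y)%:R - \sum_(z | P x z) A x z * B z y.
  have := mulmxV (unipotent_unit sP uA) => /matrixP/(_ x y); rewrite !mxE.
  rewrite (bigD1 x) //= uA ?irr // eqxx mul1r -/B => <-.
  rewrite (bigID (P x)) /= [X in _ + (_ + X)]big1 => [|z /andP[zx nPz]]; last first.
    by rewrite uA // eq_sym (negPf zx) mul0r.
  rewrite addr0 (eq_bigl (P x)) ?addrK // => z.
  by case: eqVneq => // ->; rewrite irr.
rewrite Bx big1 ?subr0 // => z Pxz; rewrite IH.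
- have [zy|zy] := eqVneq z y; last by rewrite mulr0.
  by move: nP; rewrite -zy Pxz.
- by apply: leq_trans (height_lt sP Pxz) _; rewrite -ltnS.
- by apply: contraNN nP; apply: tr.
Qed.

Lemma supported_decomp (C : fieldType) k (P : rel 'I_k) (A : 'M[C]_k) :
  strict_order P -> supported P A -> A \in unitmx ->
  exists (n : 'M[C]_k) (d : 'rV[C]_k),
    [/\ unipotent P n, forall x, d 0 x != 0 & A = n *m diag_mx d].
Proof.
move=> sP sA; rewrite unitmxE unitfE (det_supported sP sA) prodf_seq_neq0 => /allP A0.
have Axx x : A x x != 0 by apply: A0; rewrite mem_index_enum.
exists (\matrix_(x, y) (A x y / A y y)), (\row_x A x x); split.
- move=> x y nP; rewrite mxE; have [<-|xy] := eqVneq x y; first by rewrite divff.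
  by rewrite sA // mul0r.
- by move=> x; rewrite mxE.
- by apply/matrixP => x y; rewrite mul_mx_diag !mxE divfK.
Qed.

Lemma diag_mx_unit (C : fieldType) k (d : 'rV[C]_k) :
  (forall x, d 0 x != 0) -> diag_mx d \in unitmx.
Proof.
by move=> d0; rewrite unitmxE det_diag unitfE prodf_seq_neq0; apply/allP => x _; rewrite d0.
Qed.

Lemma diag_mx_supported (C : fieldType) k (P : rel 'I_k) (d : 'rV[C]_k) :
  supported P (diag_mx d).
Proof. by move=> x y /negPf xy _; rewrite mxE xy. Qed.

Lemma invmx_diag_mx (C : fieldType) k (d : 'rV[C]_k) :
  (forall x, d 0 x != 0) -> invmx (diag_mx d) = diag_mx (\row_x (d 0 x)^-1).
Proof.
move=> d0; have ud := diag_mx_unit d0; apply: (can_inj (mulKmx ud)).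
rewrite mulmxV //; apply/matrixP => x y; rewrite mul_diag_mx !mxE.
by case: eqVneq => _; rewrite ?mulr1n ?divff // mulr0n mulr0.
Qed.

Lemma supported_inv (C : fieldType) k (P : rel 'I_k) (A : 'M[C]_k) :
  strict_order P -> supported P A -> A \in unitmx -> supported P (invmx A).
Proof.
move=> sP sA uA; have [n [d [un d0 AE]]] := supported_decomp sP sA uA.
rewrite AE invmx_mul ?diag_mx_unit ?(unipotent_unit sP un) // invmx_diag_mx //.
apply: supported_mul => //; first exact: diag_mx_supported.
by apply: unipotent_supported; apply: unipotent_inv.
Qed.

Lemma borel1 (C : fieldType) k : borel (1%:M : 'M[C]_k).
Proof. by split; [exact: unitmx1|exact/unipotent_supported/unipotent1]. Qed.

Lemma borel_mul (C : fieldType) k (a b : 'M[C]_k) :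
  borel a -> borel b -> borel (a *m b).
Proof.
move=> [ua sa] [ub sb]; split; first by rewrite unitmx_mul ua.
exact: supported_mul (@strict_up k) sa sb.
Qed.

Lemma borel_inv (C : fieldType) k (b : 'M[C]_k) : borel b -> borel (invmx b).
Proof.
move=> [ub sb]; split; first by rewrite unitmx_inv.
exact: supported_inv (@strict_up k) sb ub.
Qed.

Lemma borel_unipotent (C : fieldType) k (b : 'M[C]_k) : unipotent (@up k) b -> borel b.
Proof.
by move=> ub; split; [exact: unipotent_unit (@strict_up k) ub|exact: unipotent_supported].
Qed.

Lemma borel_diag (C : fieldType) k (d : 'rV[C]_k) :
  (forall x, d 0 x != 0) -> borel (diag_mx d).
Proof. by move=> d0; split; [exact: diag_mx_unit|exact: diag_mx_supported]. Qed.

(** * Permutation matrices *)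

(** The matrix that sends e_j to e_{w(j)}.  The product [v * w] of permutations
    applies [v] first, whence the reversal in [permmxM]. *)
Definition permmx (C : fieldType) k (w : 'S_k) : 'M[C]_k := perm_mx w^-1%g.

Lemma permmxE (C : fieldType) k (w : 'S_k) x y : permmx C w x y = (x == w y)%:R.
Proof. by rewrite !mxE -(inj_eq (@perm_inj _ w)) permKV. Qed.

Lemma permmx_unit (C : fieldType) k (w : 'S_k) : permmx C w \in unitmx.
Proof. exact: unitmx_perm. Qed.

Lemma permmx1 (C : fieldType) k : permmx C (1%g : 'S_k) = 1%:M.
Proof. by rewrite /permmx invg1 perm_mx1. Qed.

Lemma permmxM (C : fieldType) k (v w : 'S_k) : permmx C v *m permmx C w = permmx C (w * v)%g.
Proof. by rewrite /permmx invMg perm_mxM. Qed.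

Lemma permmxK (C : fieldType) k m (v : 'S_k) (A : 'M[C]_(k, m)) :
  permmx C v^-1%g *m (permmx C v *m A) = A.
Proof. by rewrite mulmxA permmxM mulgV permmx1 mul1mx. Qed.

Lemma permmxKV (C : fieldType) k m (v : 'S_k) (A : 'M[C]_(k, m)) :
  permmx C v *m (permmx C v^-1%g *m A) = A.
Proof. by rewrite mulmxA permmxM mulVg permmx1 mul1mx. Qed.

Lemma mul_permmxE (C : fieldType) k (A : 'M[C]_k) (v : 'S_k) x y :
  (A *m permmx C v) x y = A x (v y).
Proof.
rewrite mxE (bigD1 (v y)) //= permmxE eqxx mulr1 big1 ?addr0 // => z /negPf zy.
by rewrite permmxE zy mulr0.
Qed.

Lemma permmx_mulE (C : fieldType) k (A : 'M[C]_k) (v : 'S_k) x y :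
  (permmx C v *m A) x y = A (v^-1%g x) y.
Proof.
rewrite mxE (bigD1 (v^-1 x)%g) //= permmxE permKV eqxx mul1r big1 ?addr0 // => z.
rewrite permmxE -(inj_eq (@perm_inj _ v)) permKV eq_sym => /negPf ->.
by rewrite mul0r.
Qed.

Lemma permmx_conjE (C : fieldType) k (A : 'M[C]_k) (v : 'S_k) x y :
  (permmx C v^-1%g *m A *m permmx C v) x y = A (v x) (v y).
Proof. by rewrite mul_permmxE permmx_mulE invgK. Qed.

Lemma unipotent_conj (C : fieldType) k (P : rel 'I_k) (A : 'M[C]_k) (v : 'S_k) :
  unipotent P A -> unipotent (relpre v P) (permmx C v^-1%g *m A *m permmx C v).
Proof. by move=> uA x y /= /uA; rewrite permmx_conjE (inj_eq (@perm_inj _ v)). Qed.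

Lemma diag_mx_permmx (C : fieldType) k (d : 'rV[C]_k) (v : 'S_k) :
  diag_mx d *m permmx C v = permmx C v *m diag_mx (\row_x d 0 (v x)).
Proof.
apply/matrixP => x y; rewrite mul_diag_mx mul_mx_diag mxE [RHS]mxE !permmxE !mxE mulrC.
by case: eqVneq => [->|]; rewrite ?mul0r.
Qed.

(** * LU decomposition *)

(** The leading block on the indices 0..j, completed by an identity block so
    that these matrices have the same size for all [j].  The determinant is the
    leading principal minor. *)
Definition trunc (C : fieldType) k (j : 'I_k) (A : 'M[C]_k) : 'M[C]_k :=
  \matrix_(x, y) if (x <= j)%N && (y <= j)%N then A x y else (x == y)%:R.

Definition has_lu (C : fieldType) k (A : 'M[C]_k) : Prop :=
  forall j, trunc j A \in unitmx.

(** The inverse of the upper factor of [A].  Column j solves the linear system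
    of the leading block on 0..j with right-hand side e_j, which is exactly what
    makes [A *m lu_inv_upper A] lower unitriangular.  The formula also shows that
    both factors are rational in the entries of [A]. *)
Definition lu_inv_upper (C : fieldType) k (A : 'M[C]_k) : 'M[C]_k :=
  \matrix_(x, j) invmx (trunc j A) x j.

Definition lu_lower (C : fieldType) k (A : 'M[C]_k) : 'M[C]_k :=
  A *m lu_inv_upper A.

Lemma lu_inv_upper_supported (C : fieldType) k (A : 'M[C]_k) :
  has_lu A -> supported (@up k) (lu_inv_upper A).
Proof.
move=> luA x j xj; rewrite /up -leqNgt leq_eqVlt eq_sym (inj_eq val_inj) (negPf xj) /= => jx.
have /matrixP/(_ x j) := mulmxV (luA j); rewrite !mxE (bigD1 x) //= mxE leqNgt jx /=.
rewrite eqxx mul1r (negPf xj) big1 ?addr0 // => z zx.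
by rewrite mxE leqNgt jx /= eq_sym (negPf zx) mul0r.
Qed.

Lemma lu_lower_unipotent (C : fieldType) k (A : 'M[C]_k) :
  has_lu A -> unipotent (@low k) (lu_lower A).
Proof.
move=> luA x j; rewrite /low -leqNgt => xj.
have /matrixP/(_ x j) := mulmxV (luA j); rewrite !mxE => <-.
apply: eq_bigr => z _; rewrite [trunc _ _ _ _]mxE xj /=.
case: leqP => jz; first by rewrite mxE.
have /negPf xz : x != z by rewrite neq_ltn (leq_ltn_trans xj jz).
rewrite (lu_inv_upper_supported luA) ?xz ?mul0r ?mulr0 //.
  by rewrite neq_ltn jz orbT.
by rewrite /up -leqNgt ltnW.
Qed.

Lemma lu_inv_upper_borel (C : fieldType) k (A : 'M[C]_k) :
  has_lu A -> borel (lu_inv_upper A).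
Proof.
move=> luA; split; last exact: lu_inv_upper_supported.
have := unipotent_unit (@strict_low k) (lu_lower_unipotent luA).
by rewrite unitmx_mul => /andP[].
Qed.

Lemma lower_upper_eq1 (C : fieldType) k (A : 'M[C]_k) :
  unipotent (@low k) A -> supported (@up k) A -> A = 1%:M.
Proof.
move=> lA uA; apply/matrixP => x y; rewrite [RHS]mxE.
have [xy|] := boolP (low x y); last exact: lA.
have neq_xy : x != y by rewrite neq_ltn [(y < x)%N]xy orbT.
by rewrite uA ?(negPf neq_xy) // /up -leqNgt ltnW.
Qed.

Lemma trunc_mul (C : fieldType) k (L b : 'M[C]_k) j :
  supported (@low k) L -> supported (@up k) b ->
  trunc j (L *m b) = trunc j L *m trunc j b.
Proof.
move=> lL ub; apply/matrixP => x y; rewrite !mxE; case: ifPn => [/andP[xj yj]|].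
  apply: eq_bigr => z _; rewrite !mxE xj yj andbT /=; case: leqP => //= jz.
  have xz : x != z by rewrite neq_ltn (leq_ltn_trans xj jz).
  rewrite lL ?(negPf xz) ?mul0r // /low -leqNgt.
  by rewrite (leq_trans xj) // ltnW.
rewrite negb_and => /orP[xj|yj].
  rewrite (bigD1 x) //= !mxE (negPf xj) /= eqxx mul1r big1 ?addr0 // => z zx.
  by rewrite mxE (negPf xj) /= eq_sym (negPf zx) mul0r.
rewrite (bigD1 y) //= !mxE (negPf yj) !andbF /= eqxx mulr1 big1 ?addr0 // => z zy.
by rewrite mxE [X in _ * X]mxE (negPf yj) !andbF (negPf zy) mulr0.
Qed.

Lemma trunc_unipotent (C : fieldType) k (P : rel 'I_k) (A : 'M[C]_k) j :
  unipotent P A -> unipotent P (trunc j A).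
Proof. by move=> uA x y nP; rewrite mxE; case: ifP => // _; apply: uA. Qed.

Lemma trunc_borel_unit (C : fieldType) k (b : 'M[C]_k) j :
  borel b -> trunc j b \in unitmx.
Proof.
move=> [ub sb]; have sj : supported (@up k) (trunc j b).
  by move=> x y xy nP; rewrite mxE (negPf xy); case: ifP => // _; apply: sb.
move: ub; rewrite !unitmxE (det_supported (@strict_up k) sj) (det_supported (@strict_up k) sb).
rewrite !unitfE !prodf_seq_neq0 => /allP b0; apply/allP => x xin.
by rewrite mxE /= eqxx; case: ifP => _; [exact: b0|exact: oner_neq0].
Qed.

Lemma has_lu_mul (C : fieldType) k (L b : 'M[C]_k) :
  unipotent (@low k) L -> borel b -> has_lu (L *m b).
Proof.
move=> uL bb j; have [_ sb] := bb.
rewrite (trunc_mul j (unipotent_supported uL) sb) unitmx_mul (trunc_borel_unit j bb) andbT.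
exact: unipotent_unit (@strict_low k) (trunc_unipotent j uL).
Qed.

(** Two lower factors of the same matrix differ by a matrix that is both lower
    unitriangular and upper triangular. *)
Lemma lu_lower_mul (C : fieldType) k (L b : 'M[C]_k) :
  unipotent (@low k) L -> borel b -> lu_lower (L *m b) = L.
Proof.
move=> uL bb; have lu := has_lu_mul uL bb; have sl := @strict_low k.
have uLu := unipotent_unit sl uL.
have E : invmx L *m lu_lower (L *m b) = b *m lu_inv_upper (L *m b).
  by rewrite /lu_lower -!mulmxA mulKmx.
have : invmx L *m lu_lower (L *m b) = 1%:M.
  apply: lower_upper_eq1.
    by apply: unipotent_mul (unipotent_inv sl uL) (lu_lower_unipotent lu).
  by rewrite E; have [] := borel_mul bb (lu_inv_upper_borel lu).
by move=> /(congr1 (mulmx L)); rewrite mulKVmx // mulmx1.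
Qed.

Lemma unipotent_has_lu (C : fieldType) k (P : rel 'I_k) (A : 'M[C]_k) :
  strict_order P -> unipotent P A -> has_lu A.
Proof. by move=> sP uA j; apply: unipotent_unit sP (trunc_unipotent j uA). Qed.

Lemma lu_inv_upper_unipotent (C : fieldType) k (P : rel 'I_k) (A : 'M[C]_k) :
  strict_order P -> unipotent P A -> unipotent P (lu_inv_upper A).
Proof.
by move=> sP uA x j nP; rewrite mxE; apply: unipotent_inv (trunc_unipotent j uA) _ _ nP.
Qed.

(** Truncation preserves the support condition, hence the LU factors of an
    element of a pattern group belong to the same group. *)
Lemma lu_lower_pattern (C : fieldType) k (P : rel 'I_k) (A : 'M[C]_k) :
  strict_order P -> unipotent P A -> unipotent P (lu_lower A).
Proof. by move=> sP uA; apply: unipotent_mul => //; apply: lu_inv_upper_unipotent. Qed.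

Lemma lu_inv_upper_unipotent_up (C : fieldType) k (P : rel 'I_k) (A : 'M[C]_k) :
  strict_order P -> unipotent P A -> unipotent (@up k) (lu_inv_upper A).
Proof.
move=> sP uA x y nup; have [<-|xy] := eqVneq x y; last first.
  by apply: lu_inv_upper_supported => //; apply: unipotent_has_lu uA.
by rewrite (lu_inv_upper_unipotent sP uA) ?eqxx //; have [->] := sP.
Qed.

(** * Bruhat cells and their affine charts *)

(** BvB for [P] equal to [up], and B_-vB for [P] equal to [low]: the torus part
    of the left factor can be moved across [v] into the right factor. *)
Definition bruhat_cell (C : fieldType) k (P : rel 'I_k) (v : 'S_k) (M : 'M[C]_k) : Prop :=
  exists n b, [/\ unipotent P n, borel b & M = n *m permmx C v *m b].

(** The unipotent matrices for this order form the group vU_-v^-1. *)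
Definition cell_order k (v : 'S_k) : rel 'I_k := relpre v^-1%g (@low k).

(** The flag of [M] belongs to the open chart vB_-B/B. *)
Definition in_chart (C : fieldType) k (v : 'S_k) (M : 'M[C]_k) : Prop :=
  has_lu (permmx C v^-1%g *m M).

(** The representative g in vU_-v^-1 of the coset of [M] in the chart, so that
    M and gv define the same flag. *)
Definition chart_coord (C : fieldType) k (v : 'S_k) (M : 'M[C]_k) : 'M[C]_k :=
  permmx C v *m lu_lower (permmx C v^-1%g *m M) *m permmx C v^-1%g.

Lemma strict_cell_order k (v : 'S_k) : strict_order (cell_order v).
Proof. exact: strict_relpre (@strict_low k). Qed.

Lemma unipotent_pullback (C : fieldType) k (P : rel 'I_k) (v : 'S_k) (A : 'M[C]_k) :
  unipotent (relpre v P) A -> unipotent P (permmx C v *m A *m permmx C v^-1%g).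
Proof.
move=> uA x y nP; rewrite mul_permmxE permmx_mulE uA ?(inj_eq (@perm_inj _ v^-1%g)) //=.
by rewrite !permKV.
Qed.

Lemma unipotent_push (C : fieldType) k (P : rel 'I_k) (v : 'S_k) (A : 'M[C]_k) :
  unipotent P A -> unipotent (relpre v^-1%g P) (permmx C v *m A *m permmx C v^-1%g).
Proof.
by move=> uA x y nP; rewrite mul_permmxE permmx_mulE uA // (inj_eq (@perm_inj _ v^-1%g)).
Qed.

Lemma chart_coordP (C : fieldType) k (v : 'S_k) (g b : 'M[C]_k) :
  unipotent (cell_order v) g -> borel b ->
  in_chart v (g *m permmx C v *m b) /\ chart_coord v (g *m permmx C v *m b) = g.
Proof.
move=> ug bb; have ul : unipotent (@low k) (permmx C v^-1%g *m g *m permmx C v).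
  move=> x y nl; rewrite permmx_conjE ug ?(inj_eq (@perm_inj _ v)) //.
  by rewrite /cell_order /= !permK.
have E : permmx C v^-1%g *m (g *m permmx C v *m b) = permmx C v^-1%g *m g *m permmx C v *m b.
  by rewrite !mulmxA.
rewrite /in_chart /chart_coord E lu_lower_mul //; split; first exact: has_lu_mul.
by rewrite -!mulmxA permmxM mulVg permmx1 mulmx1 permmxKV.
Qed.

Lemma in_chart_decomp (C : fieldType) k (v : 'S_k) (M : 'M[C]_k) :
  in_chart v M ->
  unipotent (cell_order v) (chart_coord v M) /\
  exists2 b, borel b & M = chart_coord v M *m permmx C v *m b.
Proof.
move=> cM; split; first exact: unipotent_push (lu_lower_unipotent cM).
have bC := lu_inv_upper_borel cM; exists (invmx (lu_inv_upper (permmx C v^-1%g *m M))).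
  exact: borel_inv.
by have [uC _] := bC; rewrite /chart_coord -!mulmxA permmxK /lu_lower mulmxV // mulmx1 permmxKV.
Qed.

Lemma bruhat_cell_borel (C : fieldType) k (P : rel 'I_k) v (M b : 'M[C]_k) :
  borel b -> bruhat_cell P v M -> bruhat_cell P v (M *m b).
Proof.
move=> bb [n [b' [un bb' ->]]]; exists n, (b' *m b); split=> //.
  exact: borel_mul.
by rewrite !mulmxA.
Qed.

Lemma bruhat_cell_borelP (C : fieldType) k (P : rel 'I_k) v (M b : 'M[C]_k) :
  borel b -> bruhat_cell P v (M *m b) <-> bruhat_cell P v M.
Proof.
move=> bb; split; last exact: bruhat_cell_borel.
move=> /(bruhat_cell_borel (borel_inv bb)); rewrite mulmxK //.
by case: bb.
Qed.

Lemma bruhat_cell_mul (C : fieldType) k (P : rel 'I_k) v (n M : 'M[C]_k) :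
  strict_order P -> unipotent P n -> bruhat_cell P v M -> bruhat_cell P v (n *m M).
Proof.
move=> sP un [n' [b' [un' bb' ->]]]; exists (n *m n'), b'; split=> //.
  exact: unipotent_mul.
by rewrite !mulmxA.
Qed.

(** For n unipotent, v^-1 n v belongs to a pattern group, so it has an LU
    decomposition within that group.  The lower factor, conjugated back by v,
    lies both in vU_-v^-1 and in the original group, and the upper one is
    absorbed by B. *)
Lemma bruhat_cell_chart (C : fieldType) k (P : rel 'I_k) v (M : 'M[C]_k) :
  strict_order P -> bruhat_cell P v M ->
  in_chart v M /\ unipotent P (chart_coord v M).
Proof.
move=> sP [n [b [un bb ->]]]; set A := permmx C v^-1%g *m n *m permmx C v.
have sQ := strict_relpre v sP; have uA : unipotent (relpre v P) A by apply: unipotent_conj.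
have luA := unipotent_has_lu sQ uA; have bC := lu_inv_upper_borel luA.
have nE : n *m permmx C v *m b =
    (permmx C v *m lu_lower A *m permmx C v^-1%g) *m permmx C v *m (invmx (lu_inv_upper A) *m b).
  rewrite -!mulmxA (mulmxA (permmx C v^-1%g) (permmx C v)) permmxM mulgV permmx1 mul1mx.
  have [uC _] := bC; rewrite mulmxA (mulmxA (lu_inv_upper A)) mulmxV // mul1mx.
  by rewrite !mulmxA permmxM mulVg permmx1 mul1mx.
have [||cM gE] := @chart_coordP _ _ v (permmx C v *m lu_lower A *m permmx C v^-1%g)
    (invmx (lu_inv_upper A) *m b).
- exact: unipotent_push (lu_lower_unipotent luA).
- by apply: borel_mul => //; apply: borel_inv.
rewrite nE gE; split=> //.
by apply: unipotent_pullback; apply: lu_lower_pattern.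
Qed.

Lemma bruhat_cell_self (C : fieldType) k (P : rel 'I_k) v (g : 'M[C]_k) :
  unipotent P g -> bruhat_cell P v (g *m permmx C v).
Proof. by move=> ug; exists g, 1%:M; split; rewrite ?mulmx1 //; exact: borel1. Qed.

Lemma bruhat_cell_supported (C : fieldType) k (P : rel 'I_k) v (n b : 'M[C]_k) :
  strict_order P -> supported P n -> n \in unitmx -> borel b ->
  bruhat_cell P v (n *m permmx C v *m b).
Proof.
move=> sP sn un bb; have [n' [d [un' d0 ->]]] := supported_decomp sP sn un.
exists n', (diag_mx (\row_x d 0 (v x)) *m b); split=> //.
  by apply: borel_mul => //; apply: borel_diag => x; rewrite mxE.
by rewrite -(mulmxA n') diag_mx_permmx !mulmxA.
Qed.

(** * Splicing factorizations *)

(** The factor b in g = n b with n lower and b upper unitriangular. *)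
Definition splice_left (C : fieldType) k (g : 'M[C]_k) : 'M[C]_k :=
  invmx (lu_lower g) *m g.

(** The factor a in g = n a with n upper and a lower unitriangular; it is read
    off from the LU decomposition of g^-1 = a^-1 n^-1. *)
Definition splice_right (C : fieldType) k (g : 'M[C]_k) : 'M[C]_k :=
  invmx (lu_lower (invmx g)).

(** If b a^-1 = L n is an LU decomposition, then L^-1 b = n a has left factor b
    and right factor a. *)
Definition splice_mul (C : fieldType) k (b a : 'M[C]_k) : 'M[C]_k :=
  invmx (lu_lower (b *m invmx a)) *m b.

Lemma splice_leftP (C : fieldType) k (P : rel 'I_k) (g : 'M[C]_k) :
  strict_order P -> unipotent P g ->
  unipotent P (splice_left g) /\ unipotent (@up k) (splice_left g).
Proof.
move=> sP ug; have lug := unipotent_has_lu sP ug; split.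
  by apply: unipotent_mul => //; apply: unipotent_inv => //; apply: lu_lower_pattern.
rewrite (_ : splice_left g = invmx (lu_inv_upper g)).
  by apply: unipotent_inv (@strict_up k) _; apply: lu_inv_upper_unipotent_up ug.
have uL := unipotent_unit (@strict_low k) (lu_lower_unipotent lug).
have [uC _] := lu_inv_upper_borel lug.
apply: (can_inj (mulmxK uC)); rewrite mulVmx // /splice_left -mulmxA.
by rewrite -/(lu_lower g) mulVmx.
Qed.

Lemma splice_rightP (C : fieldType) k (P : rel 'I_k) (g : 'M[C]_k) :
  strict_order P -> unipotent P g ->
  unipotent P (splice_right g) /\ unipotent (@low k) (splice_right g).
Proof.
move=> sP ug; have uV := unipotent_inv sP ug; have lug := unipotent_has_lu sP uV.
split; apply: unipotent_inv => //; first exact: lu_lower_pattern.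
  exact: strict_low.
exact: lu_lower_unipotent.
Qed.

Lemma splice_mulP (C : fieldType) k (P : rel 'I_k) (b a : 'M[C]_k) :
  strict_order P -> unipotent P b -> unipotent P a ->
  unipotent P (splice_mul b a).
Proof.
move=> sP ub ua; apply: unipotent_mul => //; apply: unipotent_inv => //.
by apply: lu_lower_pattern => //; apply: unipotent_mul => //; apply: unipotent_inv.
Qed.

Lemma splice_factor (C : fieldType) k (P : rel 'I_k) (g : 'M[C]_k) :
  strict_order P -> unipotent P g ->
  (exists2 n, unipotent (@low k) n & g = n *m splice_left g) /\
  (exists2 n, unipotent (@up k) n & g = n *m splice_right g).
Proof.
move=> sP ug; have lug := unipotent_has_lu sP ug; split.
  exists (lu_lower g); first exact: lu_lower_unipotent.
  by rewrite mulKVmx // (unipotent_unit (@strict_low k)) //; apply: lu_lower_unipotent.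
have uV := unipotent_inv sP ug; have lugV := unipotent_has_lu sP uV.
exists (lu_inv_upper (invmx g)); first exact: lu_inv_upper_unipotent_up uV.
have uL := unipotent_unit (@strict_low k) (lu_lower_unipotent lugV).
apply: (can_inj (mulmxK uL)); rewrite mulmxKV // /lu_lower mulmxA mulmxV ?mul1mx //.
exact: unipotent_unit ug.
Qed.

Lemma splice_mul_factor (C : fieldType) k (P : rel 'I_k) (b a : 'M[C]_k) :
  strict_order P -> unipotent P b -> unipotent P a ->
  (exists2 n, unipotent (@low k) n & splice_mul b a = n *m b) /\
  (exists2 n, unipotent (@up k) n & splice_mul b a = n *m a).
Proof.
move=> sP ub ua; set h := b *m invmx a.
have uh : unipotent P h by apply: unipotent_mul => //; apply: unipotent_inv.
have luh := unipotent_has_lu sP uh.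
split.
  exists (invmx (lu_lower h)) => //.
  by apply: unipotent_inv (@strict_low k) (lu_lower_unipotent luh).
exists (splice_left h); first by have [] := splice_leftP sP uh.
by rewrite /splice_mul /splice_left -/h -mulmxA mulmxKV // (unipotent_unit sP).
Qed.

Lemma splice_leftE (C : fieldType) k (n b : 'M[C]_k) :
  unipotent (@low k) n -> unipotent (@up k) b -> splice_left (n *m b) = b.
Proof.
move=> un ub; rewrite /splice_left lu_lower_mul //; last exact: borel_unipotent.
by rewrite mulKmx // (unipotent_unit (@strict_low k)).
Qed.

Lemma splice_rightE (C : fieldType) k (n a : 'M[C]_k) :
  unipotent (@up k) n -> unipotent (@low k) a -> splice_right (n *m a) = a.
Proof.
move=> un ua; have un' := unipotent_unit (@strict_up k) un.
have ua' := unipotent_unit (@strict_low k) ua.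
rewrite /splice_right invmx_mul // lu_lower_mul ?invmxK //.
  exact: unipotent_inv (@strict_low k) ua.
by apply: borel_inv; apply: borel_unipotent.
Qed.

Lemma splice_mulK (C : fieldType) k (P : rel 'I_k) (b a : 'M[C]_k) :
  strict_order P -> unipotent P b -> unipotent P a ->
  unipotent (@up k) b -> unipotent (@low k) a ->
  splice_left (splice_mul b a) = b /\ splice_right (splice_mul b a) = a.
Proof.
move=> sP ub ua upb lowa.
have [[n un gE] [n' un' gE']] := splice_mul_factor sP ub ua.
by rewrite {1}gE gE' splice_leftE // splice_rightE.
Qed.

Lemma spliceK (C : fieldType) k (P : rel 'I_k) (g : 'M[C]_k) :
  strict_order P -> unipotent P g ->
  splice_mul (splice_left g) (splice_right g) = g.
Proof.
move=> sP ug; have [[n un gE] [n' un' gE']] := splice_factor sP ug.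
have [_ upb] := splice_leftP sP ug; have [_ lowa] := splice_rightP sP ug.
have ua := unipotent_unit (@strict_low k) lowa.
have nu := unipotent_unit (@strict_low k) un.
set b := splice_left g in gE upb *; set a := splice_right g in gE' lowa ua *.
have -> : splice_mul b a = invmx (lu_lower (invmx n *m n')) *m b.
  rewrite /splice_mul; congr (invmx (lu_lower _) *m _).
  apply: (can_inj (mulmxK ua)); rewrite mulmxKV // -mulmxA -gE' gE.
  by rewrite mulKmx.
rewrite lu_lower_mul ?invmxK //; last exact: borel_unipotent.
exact: unipotent_inv (@strict_low k) un.
Qed.

(** * The open Richardson variety of a cover *)

Lemma rank_sum_delta (C : fieldType) k (T : {set 'I_k}) (f g : 'I_k -> 'I_k) :
  (\rank (\sum_(x in T) delta_mx (f x) (g x) : 'M[C]_k)%R <= #|T|)%N.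
Proof.
rewrite -sum1_card; apply: (big_ind2 (fun (A : 'M[C]_k) n => (\rank A <= n)%N)).
- by rewrite mxrank0.
- by move=> A m B n rA rB; exact: leq_trans (mxrank_add A B) (leq_add rA rB).
- by move=> x _; rewrite mxrank_delta.
Qed.

(** The principal block on [S], completed by an identity block, is triangular
    for the order given by [key], hence invertible of rank k; the completion
    accounts for at most k - #|S| of this rank. *)
Lemma rank_triangular (C : fieldType) k (N : 'M[C]_k) (S : {set 'I_k})
    (key : 'I_k -> nat) :
  {in S, forall x, N x x != 0} ->
  {in S &, forall x y, x != y -> (key x <= key y)%N -> N x y = 0} ->
  (#|S| <= \rank N)%N.
Proof.
move=> N0 tri; pose P : rel 'I_k := fun x y => (key y < key x)%N.
have sP : strict_order P.
  by split=> [x|y x z xy yz]; rewrite /P ?ltnn // (ltn_trans yz).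
pose A : 'M[C]_k := \matrix_(x, y) if (x \in S) && (y \in S) then N x y else (x == y)%:R.
have sA : supported P A.
  move=> x y xy; rewrite /P -leqNgt => lxy; rewrite mxE.
  by case: ifP => [/andP[xS yS]|]; rewrite ?(negPf xy) // tri.
have uA : A \in unitmx.
  rewrite unitmxE (det_supported sP sA) unitfE prodf_seq_neq0; apply/allP => x _.
  by rewrite mxE eqxx andbb /=; case: ifP => [/N0|]; rewrite ?oner_neq0.
pose E : 'M[C]_k := diag_mx (\row_x (x \in S)%:R).
have AE : A = E *m N *m E + \sum_(x in ~: S) delta_mx x x.
  apply/matrixP => x y; rewrite mxE [RHS]mxE mul_mx_diag mxE mul_diag_mx !mxE summxE.
  have [xS|xS] := boolP (x \in S); last first.
    rewrite !mul0r add0r (bigD1 x) ?inE //= mxE eqxx /= big1 ?addr0 => [|z].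
      by rewrite eq_sym.
    by move=> /andP[_ zx]; rewrite mxE eq_sym (negPf zx).
  rewrite mul1r [X in _ + X]big1 ?addr0 => [|z]; last first.
    by rewrite inE mxE; case: eqVneq => // <-; rewrite xS.
  have [yS|yS] := boolP (y \in S); first by rewrite mulr1.
  by rewrite mulr0; case: eqVneq => // xy; rewrite -xy xS in yS.
have := leq_trans (mxrank_add (E *m N *m E) _) (leq_add (leqnn _) (rank_sum_delta C (~: S) id id)).
rewrite -AE mxrank_unit // => rk.
have := leq_trans (mxrankM_maxl (E *m N) E) (mxrankM_maxr E N).
have := cardsC S; rewrite card_ord; lia.
Qed.

Definition corner (C : fieldType) k (p q : nat) (M : 'M[C]_k) : 'M[C]_k :=
  \matrix_(x, y) if (p <= x)%N && (y <= q)%N then M x y else 0.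

Definition corner_set k (p q : nat) (w : 'S_k) : {set 'I_k} :=
  [set d : 'I_k | (d <= q)%N && (p <= w d)%N].

(** An upper triangular factor on the left combines the rows from p on among
    themselves, and one on the right the columns up to q, so the rank of the
    corner is at most that of the corner of the permutation matrix of [w]. *)
Lemma corner_rank (C : fieldType) k (p q : nat) (w : 'S_k) (M : 'M[C]_k) :
  bruhat_cell (@up k) w M -> (\rank (corner p q M) <= #|corner_set p q w|)%N.
Proof.
move=> [n [b [un [_ sb] ->]]].
pose Pp : 'M[C]_k := diag_mx (\row_x (p <= x)%:R).
pose Qq : 'M[C]_k := diag_mx (\row_x (x <= q)%:R).
have cE (A : 'M[C]_k) : corner p q A = Pp *m A *m Qq.
  apply/matrixP => x y; rewrite mxE mul_mx_diag [RHS]mxE mul_diag_mx !mxE.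
  by case: (p <= x)%N => /=; rewrite ?mul0r // mul1r; case: ifP; rewrite ?mulr1 ?mulr0.
have Pn : Pp *m n = Pp *m n *m Pp.
  apply/matrixP => x y; rewrite mul_mx_diag mul_diag_mx !mxE.
  have [px|] := boolP (p <= x)%N; last by rewrite !mul0r.
  have [py|py] := boolP (p <= y)%N; first by rewrite mulr1.
  have lyx : (y < x)%N by rewrite -ltnNge in py; apply: leq_trans px.
  have /negPf xy : x != y by rewrite neq_ltn lyx orbT.
  by rewrite mul1r mulr0 un ?xy // /up -leqNgt ltnW.
have Qb : b *m Qq = Qq *m (b *m Qq).
  apply/matrixP => x y; rewrite mul_diag_mx mul_mx_diag !mxE.
  have [yq|] := boolP (y <= q)%N; last by rewrite !mulr0.
  have [xq|xq] := boolP (x <= q)%N; first by rewrite mul1r.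
  have lyx : (y < x)%N by rewrite -ltnNge in xq; apply: leq_ltn_trans xq.
  have xy : x != y by rewrite neq_ltn lyx orbT.
  by rewrite mulr1 mul0r sb // /up -leqNgt ltnW.
have -> : corner p q (n *m permmx C w *m b) = (Pp *m n) *m corner p q (permmx C w) *m (b *m Qq).
  by rewrite !cE !mulmxA -Pn -!mulmxA -Qb.
apply: leq_trans (mxrankM_maxl _ _) _; apply: leq_trans (mxrankM_maxr _ _) _.
rewrite (_ : corner _ _ _ = \sum_(d in corner_set p q w) delta_mx (w d) d).
  exact: rank_sum_delta.
apply/matrixP => x y; rewrite mxE summxE permmxE.
have [dS|dS] := boolP (y \in corner_set p q w).
  rewrite (bigD1 y) //= mxE eqxx andbT big1 ?addr0 => [|d /andP[_ dy]].
    move: dS; rewrite inE => /andP[-> pw]; rewrite andbT.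
    by case: eqVneq => [->|]; rewrite ?pw // if_same.
  by rewrite mxE [y == d]eq_sym (negPf dy) andbF.
rewrite big1 => [|d dS']; last first.
  by rewrite mxE; case: (eqVneq y d) => [yd|]; rewrite ?andbF // yd dS' in dS *.
move: dS; rewrite inE; case: ifP => // /andP[px yq]; rewrite yq /=.
by case: eqVneq => // <-; rewrite px.
Qed.

Lemma corner_set_row k (p q : nat) (v : 'S_k) (i j : 'I_k) :
  (i < j)%N -> (v i < v j)%N -> ~~ (v i < p <= v j)%N ->
  #|corner_set p q (tperm i j * v)%g| = #|corner_set p q v|.
Proof.
move=> lt_ij lt_v out; apply: eq_card => d; rewrite !inE permM.
by case: tpermP => // ->; lia.
Qed.

Lemma corner_set_col k (p q : nat) (v : 'S_k) (i j : 'I_k) :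
  (i < j)%N -> ~~ (i <= q < j)%N ->
  #|corner_set p q (tperm i j * v)%g| = #|corner_set p q v|.
Proof.
move=> lt_ij out; rewrite -(card_imset (corner_set p q v) (@perm_inj _ (tperm i j))).
apply: eq_card => d; rewrite -[d in RHS](tpermK i j) mem_imset; last exact: perm_inj.
rewrite !inE permM; case: tpermP => // ->; congr andb; lia.
Qed.

(** Let m = L_{c'c} be a nonzero entry below the diagonal.  Consider a corner of
    vL that contains this entry, with last column q < c' and first row p > v(c).
    If q = c or p = v(c'), then the pivots of [v] in the corner together with the
    entry form a triangular block, so the rank exceeds that of [v].
    By [corner_rank] the pair (p, q) then lies in the rectangle
    i <= q < j, v(i) < p <= v(j).  The extreme choices of p and q give
    i <= c < c' <= j and v(i) <= v(c) < v(c') <= v(j), and the cover condition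
    leaves only (c', c) = (j, i). *)
Lemma cover_support (C : fieldType) k (v : 'S_k) (i j : 'I_k) (L : 'M[C]_k) :
  (i < j)%N -> (v i < v j)%N ->
  (forall m : 'I_k, (i < m < j)%N -> ~~ (v i < v m < v j)%N) ->
  unipotent (@low k) L -> unipotent (relpre v (@low k)) L ->
  bruhat_cell (@up k) (tperm i j * v)%g (permmx C v *m L) ->
  forall x y, x != y -> (x, y) != (j, i) -> L x y = 0.
Proof.
move=> lt_ij lt_v gap lowL lowL' cell c' c neq_c neq_ji.
apply/eqP; apply: contraNT neq_ji => m0.
have lt_c : (c < c')%N by apply: contraNT m0 => nl; rewrite lowL // (negPf neq_c).
have lt_vc : (v c < v c')%N by apply: contraNT m0 => nl; rewrite lowL' // (negPf neq_c).
have count (p q : nat) : (c <= q < c')%N -> (v c < p <= v c')%N ->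
    (p = v c') \/ (q = c) ->
    (#|corner_set p q v| < #|corner_set p q (tperm i j * v)%g|)%N.
  move=> /andP[cq qc'] /andP[vcp pvc'] pq.
  apply: leq_trans (corner_rank p q cell).
  (* Rows are indexed through v, and column c is moved to position c', which
     puts the extra entry on the diagonal. *)
  pose N : 'M[C]_k := (permmx C v^-1%g *m corner p q (permmx C v *m L)) *m permmx C (tperm c c').
  apply: (@leq_trans (\rank N)); last first.
    by apply: leq_trans (mxrankM_maxl _ _) _; apply: mxrankM_maxr.
  have NE x y : N x y = if (p <= v x)%N && (tperm c c' y <= q)%N
                        then L x (tperm c c' y) else 0.
    by rewrite mul_permmxE permmx_mulE invgK mxE permmx_mulE permK.
  have c'S : c' \notin corner_set p q v by rewrite inE; lia.
  have SP x : x \in corner_set p q v ->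
      [/\ (x <= q)%N, (p <= v x)%N, x != c', x != c & tperm c c' x = x].
    move=> xS; have xc' : x != c' by apply: contraTneq xS => ->.
    move: xS; rewrite inE => /andP[xq px].
    have xc : x != c by apply: contraTneq px => ->; rewrite -ltnNge.
    by split=> //; rewrite tpermD // eq_sym.
  have -> : #|corner_set p q v|.+1 = #|c' |: corner_set p q v| by rewrite cardsU1 c'S.
  have tc' : tperm c c' c' = c by rewrite tpermR.
  have diag : {in c' |: corner_set p q v, forall x, N x x != 0}.
    move=> x; rewrite in_setU1 => /orP[/eqP->|/SP[xq px _ _ tx]].
      by rewrite NE tc' pvc' cq.
    by rewrite NE tx px xq lowL ?eqxx ?oner_neq0 // /low ltnn.
  have offdiag x y : x \in corner_set p q v -> y \in corner_set p q v -> x != y ->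
      (x <= y)%N -> N x y = 0.
    move=> _ /SP[_ _ _ _ ty] /negPf xy le_xy.
    by rewrite NE ty lowL ?xy ?if_same // /low -leqNgt.
  (* For p = v(c') the row c' vanishes on the pivot columns, so c' comes first;
     for q = c the column of the entry vanishes on the pivot rows, so c' comes last. *)
  case: pq => [pE|qE].
    apply: (rank_triangular (key := fun d => if d == c' then 0%N else d.+1)) => // x y.
    rewrite !in_setU1 => /orP[/eqP->|xS] /orP[/eqP->|yS]; rewrite ?eqxx //.
    - move=> c'y _; have [yq py _ _ ty] := SP _ yS; rewrite NE ty.
      by rewrite lowL' ?(negPf c'y) ?if_same //= /low -leqNgt -pE.
    - by have [_ _ /negPf -> _ _] := SP _ xS.
    - have [_ _ /negPf -> _ _] := SP _ xS; have [_ _ /negPf -> _ _] := SP _ yS.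
      by move=> xy le_xy; apply: offdiag.
  apply: (rank_triangular (key := fun d => if d == c' then k.+1 else d)) => // x y.
  rewrite !in_setU1 => /orP[/eqP->|xS] /orP[/eqP->|yS]; rewrite ?eqxx //.
  - have [_ _ /negPf -> _ _] := SP _ yS => _; have := ltn_ord y; lia.
  - move=> _ _; have [xq _ _ xc _] := SP _ xS; rewrite NE tc' lowL ?(negPf xc) ?if_same //.
    by rewrite /low -leqNgt -qE.
  - have [_ _ /negPf -> _ _] := SP _ xS; have [_ _ /negPf -> _ _] := SP _ yS.
    by move=> xy le_xy; apply: offdiag.
have row p q : (c <= q < c')%N -> (v c < p <= v c')%N -> (p = v c') \/ (q = c) ->
    (i <= q < j)%N /\ (v i < p <= v j)%N.
  move=> hq hp pq; have := count p q hq hp pq => lt_count; split; apply/negPn/negP => out.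
    by rewrite corner_set_col // ltnn in lt_count.
  by rewrite corner_set_row // ltnn in lt_count.
have [h1 h2] := row (v c') c ltac:(lia) ltac:(lia) (or_introl erefl).
have [h3 _] := row (v c') c'.-1 ltac:(lia) ltac:(lia) (or_introl erefl).
have [_ h4] := row (v c).+1 c ltac:(lia) ltac:(lia) (or_intror erefl).
have ic : i = c.
  apply/eqP; apply: contraT => ic; have ci : val i != val c by rewrite (inj_eq val_inj).
  have vci : val (v i) != val (v c) by rewrite (inj_eq val_inj) (inj_eq perm_inj).
  by have := gap c; move: ci vci => /=; lia.
have jc : j = c'.
  apply/eqP; apply: contraT => jc; have cj : val j != val c' by rewrite (inj_eq val_inj).
  have vcj : val (v j) != val (v c') by rewrite (inj_eq val_inj) (inj_eq perm_inj).
  by have := gap c'; move: cj vcj => /=; lia.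
by rewrite ic jc.
Qed.

Definition root_mx (C : fieldType) k (y x : 'I_k) (s : C) : 'M[C]_k :=
  1%:M + s *: delta_mx y x.

Lemma root_mxE (C : fieldType) k (y x a b : 'I_k) (s : C) :
  root_mx y x s a b = (a == b)%:R + s * ((a == y) && (b == x))%:R.
Proof. by rewrite !mxE. Qed.

Lemma root_mx_unipotent (C : fieldType) k (P : rel 'I_k) (y x : 'I_k) (s : C) :
  P y x -> unipotent P (root_mx y x s).
Proof.
move=> Pyx a b nP; rewrite root_mxE; have [/andP[/eqP ay /eqP bx]|_] := boolP (_ && _).
  by move: nP; rewrite ay bx Pyx.
by rewrite mulr0 addr0.
Qed.

Lemma root_mx_conj (C : fieldType) k (v : 'S_k) (y x : 'I_k) (s : C) :
  permmx C v^-1%g *m root_mx (v y) (v x) s *m permmx C v = root_mx y x s.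
Proof. by apply/matrixP => a b; rewrite permmx_conjE !root_mxE !(inj_eq (@perm_inj _ v)). Qed.

Lemma root_mx_permmx (C : fieldType) k (v : 'S_k) (y x : 'I_k) (s : C) :
  root_mx (v y) (v x) s *m permmx C v = permmx C v *m root_mx y x s.
Proof. by rewrite -(root_mx_conj v y x s) -!mulmxA permmxKV. Qed.

Lemma root_mx_inv (C : fieldType) k (y x : 'I_k) (s : C) :
  y != x -> root_mx y x s *m root_mx y x (- s) = 1%:M.
Proof.
move=> yx; rewrite /root_mx mulmxDl mul1mx mulmxDr mulmx1 -scalemxAl -scalemxAr.
rewrite mul_delta_mx_cond eq_sym (negPf yx) mulr0n !scaler0 addr0.
by rewrite -addrA scaleNr addNr addr0.
Qed.

(** In SL_2, for s nonzero,
    (1 0; s 1) = (1 1/s; 0 1) (0 1; 1 0) (s 1; 0 -1/s).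
    The last factor is recovered from the others, so that only its vanishing
    below the diagonal has to be checked. *)
Lemma root_curve_cell (C : fieldType) k (v : 'S_k) (i j : 'I_k) (s : C) :
  (i < j)%N -> (v i < v j)%N -> s != 0 ->
  bruhat_cell (@up k) (tperm i j * v)%g (root_mx (v j) (v i) s *m permmx C v).
Proof.
move=> lt_ij lt_v s0; have neq_ij : i != j by rewrite neq_ltn lt_ij.
pose b : 'M[C]_k := permmx C (tperm i j) *m (root_mx i j (- s^-1) *m root_mx j i s).
exists (root_mx (v i) (v j) s^-1), b; split.
- exact: root_mx_unipotent.
- split.
    rewrite !unitmx_mul permmx_unit /= (unipotent_unit (@strict_up k)) /=; last first.
      exact: root_mx_unipotent.
    by apply: (unipotent_unit (@strict_low k)); apply: root_mx_unipotent.
  have E : root_mx i j (- s^-1) *m root_mx j i s =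
      1%:M + s *: delta_mx j i - s^-1 *: delta_mx i j - delta_mx i i.
    rewrite /root_mx mulmxDl mul1mx mulmxDr mulmx1 -scalemxAl -scalemxAr mul_delta_mx.
    by rewrite scalerA mulNr mulVf // !scaleNr scale1r addrA.
  move=> x y xy; rewrite /up -leqNgt leq_eqVlt eq_sym (inj_eq val_inj) (negPf xy) /=.
  move=> yx; rewrite permmx_mulE E tpermV !mxE.
  case: tpermP => [xi|xj|/eqP xi /eqP xj].
  + have yi : y != i by rewrite neq_ltn -xi yx.
    have yj : y != j by rewrite neq_ltn (ltn_trans _ lt_ij) // -xi.
    by rewrite eqxx (negPf yi) (negPf yj) eq_sym (negPf yj) !andbF !mulr0 !subr0 addr0.
  + have yj : y != j by rewrite neq_ltn -xj yx.
    rewrite (negPf neq_ij) eqxx /= (negPf yj) [i == y]eq_sym.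
    by rewrite mulr0 mulr0 addr0 subr0 subrr.
  + by rewrite (negPf xy) (negPf xi) (negPf xj) !mulr0 !subr0 addr0.
- rewrite /b -permmxM root_mx_permmx mulmxA.
  have -> : root_mx (v i) (v j) s^-1 *m (permmx C v *m permmx C (tperm i j)) *m
      permmx C (tperm i j) =
      root_mx (v i) (v j) s^-1 *m permmx C v.
    by rewrite -!mulmxA permmxM tperm2 permmx1 mulmx1.
  by rewrite root_mx_permmx -mulmxA [_ *m (_ *m root_mx j i s)]mulmxA root_mx_inv // mul1mx.
Qed.

(** If v were in BwB, then w would lie in BvB and hence in the chart at v, but
    the leading minor of v^-1 w that ends at position i is zero. *)
Lemma bruhat_cell_neq (C : fieldType) k (v : 'S_k) (i j : 'I_k) :
  (i < j)%N -> ~ bruhat_cell (@up k) (tperm i j * v)%g (permmx C v).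
Proof.
move=> lt_ij [n [b [un bb E]]]; have nu := unipotent_unit (@strict_up k) un.
have /(bruhat_cell_chart (@strict_up k))[+ _] :
    bruhat_cell (@up k) v (permmx C (tperm i j * v)%g).
  exists (invmx n), (invmx b); split.
  - exact: unipotent_inv (@strict_up k) un.
  - exact: borel_inv.
  - by have [bu _] := bb; rewrite E -!mulmxA mulmxV // mulmx1 mulKmx.
rewrite /in_chart permmxM -mulgA mulgV mulg1 => /(_ i).
rewrite unitmxE (_ : \det _ = 0) ?unitr0 //.
rewrite (expand_det_col _ i) big1 // => x _; rewrite mxE leqnn andbT permmxE tpermL.
case: ifP => [xi|/negbT]; last first.
  by rewrite -ltnNge => ix; rewrite -(inj_eq val_inj) gtn_eqF ?mul0r.
by case: eqVneq => [xj|]; rewrite ?mul0r //; move: xi; rewrite xj leqNgt lt_ij.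
Qed.

Lemma cover_curve (C : fieldType) k (v : 'S_k) (i j : 'I_k) (g : 'M[C]_k) :
  (i < j)%N -> (v i < v j)%N ->
  (forall m : 'I_k, (i < m < j)%N -> ~~ (v i < v m < v j)%N) ->
  unipotent (@low k) g -> unipotent (cell_order v) g ->
  bruhat_cell (@up k) (tperm i j * v)%g (g *m permmx C v) ->
  g (v j) (v i) != 0 /\ g = root_mx (v j) (v i) (g (v j) (v i)).
Proof.
move=> lt_ij lt_v gap lowg ug cell; pose L := permmx C v^-1%g *m g *m permmx C v.
have VL : permmx C v *m L = g *m permmx C v by rewrite /L -!mulmxA permmxKV.
have lowL : unipotent (@low k) L.
  move=> x y nl; rewrite permmx_conjE ug ?(inj_eq (@perm_inj _ v)) //.
  by rewrite /cell_order /= !permK.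
have LE x y : x != y -> (x, y) != (j, i) -> L x y = 0.
  apply: (cover_support lt_ij lt_v gap) => //; last by rewrite VL.
  exact: unipotent_conj.
have gE : g = root_mx (v j) (v i) (g (v j) (v i)).
  apply/matrixP => a b; rewrite root_mxE -(permKV v a) -(permKV v b).
  set x := (v^-1 a)%g; set y := (v^-1 b)%g.
  rewrite !(inj_eq (@perm_inj _ v)) -[g (v x) _]permmx_conjE -/L.
  have [<-|xy] := eqVneq x y.
    rewrite lowL ?eqxx /low ?ltnn // -[LHS]addr0; congr (_ + _).
    case: eqVneq => [->|]; last by rewrite mulr0.
    by rewrite -(inj_eq val_inj) gtn_eqF ?mulr0.
  have [[xj yi]|nji] := eqVneq (x, y) (j, i).
    by rewrite xj yi !eqxx mulr1 add0r permmx_conjE.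
  rewrite LE // add0r; move: nji; rewrite xpair_eqE => /negPf ->.
  by rewrite mulr0.
split=> //; apply/eqP => s0; apply: (@bruhat_cell_neq C k v i j lt_ij).
suff g1 : g = 1%:M by move: cell; rewrite g1 mul1mx.
by rewrite gE s0 /root_mx scale0r addr0.
Qed.

Local Open Scope classical_set_scope.

(** * Spaces with functions *)

(** The axioms of a space with functions: openness and regularity are local,
    regular functions form algebras, and the inverse of a regular function is
    regular on its nonvanishing locus, which is open. *)
Record is_swf (C : fieldType) (X : fspace C) : Prop := IsSwf {
  swf_openT : @zopen C X setT;
  swf_openI : forall U V : set X, zopen U -> zopen V -> zopen (U `&` V);
  swf_open_local : forall U : set X,
    (forall x, U x -> exists V : set X, [/\ zopen V, V x & V `<=` U]) ->
    zopen U;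
  swf_regular_local : forall (U : set X) (f : X -> C),
    (forall x, U x -> exists (V : set X) (g : X -> C),
       [/\ zopen V, V x, regular V g & forall y, U y -> V y -> f y = g y]) ->
    regular U f;
  swf_const : forall (U : set X) (c : C), regular U (fun=> c);
  swf_add : forall (U : set X) (f g : X -> C), regular U f -> regular U g ->
    regular U (fun x => f x + g x);
  swf_mul : forall (U : set X) (f g : X -> C), regular U f -> regular U g ->
    regular U (fun x => f x * g x);
  swf_open_neq0 : forall (U : set X) (f : X -> C), zopen U -> regular U f ->
    zopen (U `&` [set x | f x != 0]);
  swf_inv : forall (U : set X) (f : X -> C), regular U f ->
    regular (U `&` [set x | f x != 0]) (fun x => (f x)^-1) }.

Lemma swf_ext (C : fieldType) (X : fspace C) (U V : set X) (f g : X -> C) :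
  is_swf X -> zopen V -> U `<=` V -> regular V g ->
  (forall x, U x -> f x = g x) -> regular U f.
Proof.
move=> nX oV UV rg fg; apply: (swf_regular_local nX) => x Ux.
by exists V, g; split=> // [|y Uy _]; [exact: UV | exact: fg].
Qed.

Lemma swf_sub (C : fieldType) (X : fspace C) (U V : set X) (f : X -> C) :
  is_swf X -> zopen V -> U `<=` V -> regular V f -> regular U f.
Proof. by move=> nX oV UV rf; apply: (swf_ext nX oV UV rf). Qed.

Lemma swf_generated (C : fieldType) (X : fspace C) (U : set X)
    (T : Type) (f : X -> T) (G : set (T -> C)) (p : T -> C) :
  is_swf X -> (forall h, G h -> regular U (h \o f)) ->
  generated_algebra G p -> regular U (p \o f).
Proof.
move=> nX GU; elim=> [h /GU//|c|h1 h2 _ ? _ ?|h1 h2 _ ? _ ?].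
- exact: (swf_const nX).
- exact: (swf_add nX).
- exact: (swf_mul nX).
Qed.

Lemma generated_algebraS (C : fieldType) (T : Type) (G G' : set (T -> C)) p :
  G `<=` G' -> generated_algebra G p -> generated_algebra G' p.
Proof.
move=> GG'; elim=> [h /GG' ?|c|h1 h2 _ ? _ ?|h1 h2 _ ? _ ?].
- exact: GenIn.
- exact: GenConst.
- exact: GenAdd.
- exact: GenMul.
Qed.

(** Without a common refinement of two charts, sums of regular functions need
    not be regular. *)
Definition directed_charts (C : fieldType) (T : Type)
    (chart : set T -> set (T -> C) -> Prop) : Prop :=
  (exists G, chart setT G) /\
  forall V V' G G', chart V G -> chart V' G' ->
    exists G'', [/\ chart (V `&` V') G'', G `<=` G'' & G' `<=` G''].

Lemma swf_chart_space (C : fieldType) (T : Type)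
    (chart : set T -> set (T -> C) -> Prop) :
  directed_charts chart -> is_swf (chart_space chart).
Proof.
move=> [[G0 cG0] dir]; split=> /=.
- move=> x _; exists setT, G0, (fun=> 1).
  by split=> //; [exact: GenConst | exact: oner_neq0].
- move=> U V oU oV x [/oU[W [G [p [cG Gp Wx px pU]]]]].
  move=> /oV[W' [G' [p' [cG' Gp' Wx' px' pV]]]].
  have [G'' [cG'' GG GG']] := dir _ _ _ _ cG cG'.
  exists (W `&` W'), G'', (fun x => p x * p' x); split=> //.
  + by apply: GenMul; [exact: generated_algebraS Gp|exact: generated_algebraS Gp'].
  + by rewrite mulf_neq0.
  + by move=> y [Wy W'y]; rewrite mulf_eq0 negb_or => /andP[? ?]; split;
      [exact: pU|exact: pV].
- move=> U locU x /locU[V [oV Vx VU]].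
  have [W [G [p [? ? ? ? pV]]]] := oV x Vx.
  by exists W, G, p; split=> // y Wy py; apply: VU; exact: pV.
- move=> U f locf x /[dup] Ux /locf[V [g [oV Vx rg fg]]].
  have [W [G [p [cG Gp Wx px pV]]]] := oV x Vx.
  have [W' [G' [a [b [cG' Ga Gb [Wx' bx] gab]]]]] := rg x Vx.
  have [G'' [cG'' GG GG']] := dir _ _ _ _ cG cG'.
  have Gp'' := generated_algebraS GG Gp.
  have Ga'' := generated_algebraS GG' Ga.
  have Gb'' := generated_algebraS GG' Gb.
  exists (W `&` W'), G'', (fun x => a x * p x), (fun x => b x * p x).
  split=> //; [exact: GenMul|exact: GenMul| by split=> //; rewrite mulf_neq0|].
  move=> y Uy [Wy W'y]; rewrite mulf_eq0 negb_or => /andP[by0 py0].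
  have Vy : V y by exact: pV.
  by rewrite fg // gab // -mulf_div divff // mulr1.
- move=> U c x Ux; exists setT, G0, (fun=> c), (fun=> 1).
  split=> //; [exact: GenConst|exact: GenConst| |].
    by split=> //; exact: oner_neq0.
  by move=> *; rewrite divr1.
- move=> U f g rf rg x Ux.
  have [W [G [a [b [cG Ga Gb [Wx bx] fab]]]]] := rf x Ux.
  have [W' [G' [c [d [cG' Gc Gd [Wx' dx] gcd]]]]] := rg x Ux.
  have [G'' [cG'' GG GG']] := dir _ _ _ _ cG cG'.
  have Ga'' := generated_algebraS GG Ga.
  have Gb'' := generated_algebraS GG Gb.
  have Gc'' := generated_algebraS GG' Gc.
  have Gd'' := generated_algebraS GG' Gd.
  exists (W `&` W'), G'', (fun x => a x * d x + c x * b x), (fun x => b x * d x).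
  split=> //; [|exact: GenMul|by split=> //; rewrite mulf_neq0|].
    by apply: GenAdd; apply: GenMul.
  move=> y Uy [Wy W'y]; rewrite mulf_eq0 negb_or => /andP[by0 dy0].
  by rewrite fab // gcd // addf_div.
- move=> U f g rf rg x Ux.
  have [W [G [a [b [cG Ga Gb [Wx bx] fab]]]]] := rf x Ux.
  have [W' [G' [c [d [cG' Gc Gd [Wx' dx] gcd]]]]] := rg x Ux.
  have [G'' [cG'' GG GG']] := dir _ _ _ _ cG cG'.
  have Ga'' := generated_algebraS GG Ga.
  have Gb'' := generated_algebraS GG Gb.
  have Gc'' := generated_algebraS GG' Gc.
  have Gd'' := generated_algebraS GG' Gd.
  exists (W `&` W'), G'', (fun x => a x * c x), (fun x => b x * d x).
  split=> //; [exact: GenMul|exact: GenMul|by split=> //; rewrite mulf_neq0|].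
  move=> y Uy [Wy W'y]; rewrite mulf_eq0 negb_or => /andP[by0 dy0].
  by rewrite fab // gcd // mulf_div.
- move=> U f oU rf x [Ux /= fx].
  have [W [G [a [b [cG Ga Gb [Wx bx] fab]]]]] := rf x Ux.
  have [W' [G' [p [cG' Gp Wx' px pU]]]] := oU x Ux.
  have [G'' [cG'' GG GG']] := dir _ _ _ _ cG cG'.
  have Ga'' := generated_algebraS GG Ga.
  have Gb'' := generated_algebraS GG Gb.
  have Gp'' := generated_algebraS GG' Gp.
  exists (W `&` W'), G'', (fun x => a x * b x * p x); split=> //.
  + by apply: GenMul => //; apply: GenMul.
  + rewrite !mulf_neq0 //; apply: contra_neq fx => ax.
    by rewrite fab // ax mul0r.
  + move=> y [Wy W'y]; rewrite !mulf_eq0 !negb_or -andbA => /and3P[ay by0 py].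
    have Uy : U y by exact: pU.
    by split=> //=; rewrite fab // mulf_neq0 // invr_neq0.
- move=> U f rf x [Ux /= fx].
  have [W [G [a [b [cG Ga Gb [Wx bx] fab]]]]] := rf x Ux.
  exists W, G, (fun x => b x * b x), (fun x => a x * b x).
  split=> //; [exact: GenMul|exact: GenMul| |].
    split=> //; rewrite mulf_neq0 //; apply: contra_neq fx => ax.
    by rewrite fab // ax mul0r.
  move=> y [Uy _] Wy; rewrite mulf_eq0 negb_or => /andP[ay0 by0].
  by rewrite fab // invf_div -mulf_div divff // mulr1.
Qed.

Lemma swf_affine_line (C : fieldType) : is_swf (affine_line C).
Proof.
apply: swf_chart_space; split; first by eexists.
move=> V V' G G' [-> ->] [-> ->]; exists [set id].
by rewrite setIT; split=> // x.
Qed.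

Lemma swf_matrix_space (C : fieldType) m n : is_swf (matrix_space C m n).
Proof.
apply: swf_chart_space; split; first by eexists; split; reflexivity.
move=> V V' G G' [-> ->] [-> ->]; eexists; rewrite setIT.
by split; [split; reflexivity|move=> x|move=> x].
Qed.

Lemma swf_subspace (C : fieldType) (X : fspace C) (A : set X) :
  is_swf X -> is_swf (subspace A).
Proof.
move=> nX; split=> /=.
- by exists setT; [exact: swf_openT|].
- move=> _ _ [U oU ->] [V oV ->]; exists (U `&` V) => //; exact: swf_openI.
- move=> U locU.
  exists [set x | exists V : set X, [/\ zopen V, V x & sval @^-1` V `<=` U]].
    apply: (swf_open_local nX) => x [V [oV Vx VU]]; exists V; split=> // y Vy.
    by exists V.
  apply/seteqP; split=> x /=; last by move=> [V [_ Vx]]; apply.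
  by move=> /locU[_ [[V oV ->] Vx VU]]; exists V.
- move=> U f locf x Ux; have [_ [g [[V oV ->] Vx rg fg]]] := locf x Ux.
  have [W [h [oW rh Wx gh]]] := rg x Vx.
  exists (V `&` W), h; split=> //; first exact: swf_openI.
    by apply: (swf_sub nX oW) => // y [].
  by move=> y Uy [Vy Wy]; rewrite fg // gh.
- move=> U c x Ux; exists setT, (fun=> c); split=> //; first exact: swf_openT.
  exact: swf_const.
- move=> U f g rf rg x Ux.
  have [V [h [oV rh Vx fh]]] := rf x Ux.
  have [V' [h' [oV' rh' Vx' gh']]] := rg x Ux.
  exists (V `&` V'), (fun x => h x + h' x); split=> //.
  + exact: swf_openI.
  + by apply: swf_add => //; [apply: (swf_sub nX oV)|apply: (swf_sub nX oV')] => // y [].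
  + by move=> y Uy [Vy Vy']; rewrite fh // gh'.
- move=> U f g rf rg x Ux.
  have [V [h [oV rh Vx fh]]] := rf x Ux.
  have [V' [h' [oV' rh' Vx' gh']]] := rg x Ux.
  exists (V `&` V'), (fun x => h x * h' x); split=> //.
  + exact: swf_openI.
  + by apply: swf_mul => //; [apply: (swf_sub nX oV)|apply: (swf_sub nX oV')] => // y [].
  + by move=> y Uy [Vy Vy']; rewrite fh // gh'.
- move=> _ f [U oU ->] rf.
  exists [set x | exists V : set X,
    [/\ zopen V, V x & sval @^-1` V `<=` [set y : {x | A x} | U (sval y) /\ f y != 0]]].
    apply: (swf_open_local nX) => x [V [oV Vx VU]]; exists V; split=> // y Vy.
    by exists V.
  apply/seteqP; split=> x /=; last by move=> [V [_ Vx]]; apply.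
  move=> [Ux fx]; have [V [h [oV rh Vx fh]]] := rf x Ux.
  exists (U `&` (V `&` [set y | h y != 0])); split.
  + by apply: swf_openI => //; apply: swf_open_neq0.
  + by split=> //; split=> //=; rewrite -fh.
  + by move=> y [Uy [Vy /= hy]] /=; split=> //; rewrite fh.
- move=> U f rf x [Ux /= fx]; have [V [h [oV rh Vx fh]]] := rf x Ux.
  exists (V `&` [set y | h y != 0]), (fun x => (h x)^-1); split.
  + exact: swf_open_neq0.
  + exact: swf_inv.
  + by split=> //=; rewrite -fh.
  + by move=> y [Uy _] [Vy _]; rewrite fh.
Qed.

Lemma swf_quotient_space (C : fieldType) (X : fspace C) (T : Type) (pi : X -> T) :
  is_swf X -> is_swf (quotient_space pi).
Proof.
move=> nX; split=> /=.
- exact: swf_openT.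
- by move=> U V; apply: swf_openI.
- move=> U locU; apply: (swf_open_local nX) => x /locU[V [oV Vx VU]].
  by exists (pi @^-1` V); split=> // y; apply: VU.
- move=> U f locf; apply: (swf_regular_local nX) => x /locf[V [g [oV Vx rg fg]]].
  by exists (pi @^-1` V), (g \o pi); split=> // y; apply: fg.
- by move=> U c; apply: swf_const.
- by move=> U f g; apply: swf_add.
- by move=> U f g; apply: swf_mul.
- by move=> U f; apply: (@swf_open_neq0 _ _ nX _ (f \o pi)).
- by move=> U f; apply: (@swf_inv _ _ nX _ (f \o pi)).
Qed.

Lemma swf_open_bigcap (C : fieldType) (X : fspace C) (I : finType)
    (U : I -> set X) :
  is_swf X -> (forall i, zopen (U i)) -> zopen [set x | forall i, U i x].
Proof.
move=> nX oU.
have oE (s : seq I) : zopen [set x | forall i, i \in s -> U i x].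
  elim: s => [|i s IH].
    rewrite [X in zopen X](_ : _ = setT); first exact: swf_openT.
    by apply/seteqP; split.
  rewrite [X in zopen X](_ : _ = U i `&` [set x | forall j, j \in s -> U j x]).
    exact: swf_openI.
  apply/seteqP; split=> x /=.
    by move=> Ux; split=> [|j js]; apply: Ux; rewrite inE ?eqxx ?js ?orbT.
  by move=> [Ui Us] j; rewrite inE => /orP[/eqP->|/Us].
rewrite [X in zopen X](_ : _ = [set x | forall i, i \in enum I -> U i x]) //.
by apply/seteqP; split=> x /= Ux i => [_|]; apply: Ux; rewrite ?mem_enum.
Qed.

Lemma swf_product_space (C : fieldType) (I : finType) (X : I -> fspace C) :
  (forall i, is_swf (X i)) -> is_swf (product_space X).
Proof.
move=> nX; apply: swf_chart_space; split.
  eexists; exists (fun i => setT); first by move=> i; apply: swf_openT.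
  by split; [apply/seteqP; split|reflexivity].
move=> _ _ _ _ [U oU [-> ->]] [U' oU' [-> ->]]; eexists; split.
- exists (fun i => U i `&` U' i); first by move=> i; apply: swf_openI.
  split; last reflexivity.
  apply/seteqP; split=> x /=; first by move=> [Ux Ux'] i; split.
  by move=> Ux; split=> i; have [] := Ux i.
- move=> _ [i [h [rh ->]]]; exists i, h; split=> //.
  by apply: (swf_sub (nX i) (oU i)) => // y [].
- move=> _ [i [h [rh ->]]]; exists i, h; split=> //.
  by apply: (swf_sub (nX i) (oU' i)) => // y [].
Qed.

Lemma morphism_comp (C : fieldType) (X Y Z : fspace C) (g : Y -> Z) (f : X -> Y) :
  is_morphism g -> is_morphism f -> is_morphism (g \o f).
Proof.
move=> [og rg] [of_ rf]; split=> [V oV|V h oV rh].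
  exact: (of_ _ (og _ oV)).
exact: (rf _ _ (og _ oV) (rg _ _ oV rh)).
Qed.

(** It suffices to test a map on the generators: fractions of polynomials in
    them pull back to fractions of regular functions. *)
Lemma morphism_to_chart_space (C : fieldType) (X : fspace C) (T : Type)
    (chart : set T -> set (T -> C) -> Prop) (f : X -> chart_space chart) :
  is_swf X ->
  (forall V G, chart V G ->
     zopen (f @^-1` V) /\ forall h, G h -> regular (f @^-1` V) (h \o f)) ->
  is_morphism f.
Proof.
move=> nX cf; split=> [V oV|V h oV rh].
  apply: (swf_open_local nX) => x Vx.
  have [W [G [q [cG Gq Wx qx qV]]]] := oV _ Vx.
  have [oW rG] := cf _ _ cG.
  exists (f @^-1` W `&` [set x | (q \o f) x != 0]); split=> //.
    by apply: (swf_open_neq0 nX) => //; apply: swf_generated Gq.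
  by move=> y [Wy qy]; apply: qV.
apply: (swf_regular_local nX) => x Vx.
have [W [G [p [q [cG Gp Gq [Wx qx] hpq]]]]] := rh _ Vx.
have [W' [G' [q' [cG' Gq' Wx' qx' qV']]]] := oV _ Vx.
have [oW rG] := cf _ _ cG.
have rp : regular (f @^-1` W) (p \o f) by apply: swf_generated Gp.
have rq : regular (f @^-1` W) (q \o f) by apply: swf_generated Gq.
have oWq := swf_open_neq0 nX oW rq.
exists (f @^-1` W `&` [set x | (q \o f) x != 0]), (fun x => p (f x) / q (f x)).
split=> //; last by move=> y Vy [Wy qy]; apply: hpq.
apply: (swf_mul nX); last exact: swf_inv.
by apply: (swf_sub nX oW) rp => y [].
Qed.

Lemma morphism_to_matrix_space (C : fieldType) (X : fspace C) m n
    (f : X -> matrix_space C m n) :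
  is_swf X -> (forall i j, regular setT (fun x => f x i j)) -> is_morphism f.
Proof.
move=> nX rf; apply: morphism_to_chart_space => // _ _ [-> ->]; split.
  exact: swf_openT.
by move=> _ [i [j ->]]; apply: rf.
Qed.

Lemma morphism_to_affine_line (C : fieldType) (X : fspace C)
    (f : X -> affine_line C) :
  is_swf X -> regular setT f -> is_morphism f.
Proof.
move=> nX rf; apply: morphism_to_chart_space => // _ _ [-> ->]; split.
  exact: swf_openT.
by move=> _ ->.
Qed.

Lemma morphism_to_subspace (C : fieldType) (X Y : fspace C) (A : set Y)
    (f : X -> subspace A) :
  is_swf X -> is_morphism (fun x => sval (f x) : Y) -> is_morphism f.
Proof.
move=> nX [of_ rf]; split=> [_ [V oV ->]|_ h [V oV ->] rh]; first exact: of_.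
apply: (swf_regular_local nX) => x Vx.
have [W [g [oW rg Wx hg]]] := rh _ Vx.
exists ((fun x => sval (f x)) @^-1` W), (fun x => g (sval (f x))); split=> //.
- exact: of_.
- exact: (rf _ _ oW rg).
- by move=> y Vy Wy; apply: hg.
Qed.

Lemma morphism_sval (C : fieldType) (X : fspace C) (A : set X) :
  is_morphism (sval : subspace A -> X).
Proof.
split=> [V oV|V h oV rh]; first by exists V.
by move=> x Vx; exists V, h; split.
Qed.

Lemma morphism_quotient (C : fieldType) (X : fspace C) (T : Type) (pi : X -> T) :
  is_morphism (pi : X -> quotient_space pi).
Proof. by split. Qed.

(** A function on the factor i is regular on the box whose other sides are the
    full spaces; the sides are defined by transport along [i = j]. *)
Lemma morphism_proj (C : fieldType) (I : finType) (X : I -> fspace C) (i : I) :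
  (forall j, is_swf (X j)) ->
  is_morphism (fun x : product_space X => x i).
Proof.
move=> nX.
have oT (V : set (X i)) : zopen V -> forall x : product_space X, V (x i) ->
    exists2 U : forall j, set (X j), (forall j, zopen (U j)) &
      (forall j, U j (x j)) /\ (forall h : X i -> C, regular V h -> regular (U i) h)
      /\ (forall y, U i y -> V y).
  move=> oV x Vx; exists (fun j => [set y | forall e : i = j, V (ecast j (X j) (esym e) y)]).
    move=> j; case: (pselect (i = j)) => [e|nij].
      case: j / e; rewrite [X in zopen X](_ : _ = V) //.
      apply/seteqP; split=> y /=; first by move=> /(_ erefl).
      by move=> Vy e; rewrite (Prop_irrelevance e erefl).
    rewrite [X in zopen X](_ : _ = setT); first exact: swf_openT.
    by apply/seteqP; split=> y //= _ e; case: nij.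
  split; first by move=> j e; case: j / e.
  split; last by move=> y /(_ erefl).
  move=> h; congr (regular _ h); apply/seteqP; split=> y /=; last by move=> /(_ erefl).
  by move=> Vy e; rewrite (Prop_irrelevance e erefl).
split=> [V oV|V h oV rh] x /= Vx; have [U oU [Ux [rU UV]]] := oT V oV x Vx.
  exists [set x | forall j, U j (x j)]; eexists; exists (fun=> 1); split.
  - by exists U => //; split; reflexivity.
  - exact: GenConst.
  - by [].
  - exact: oner_neq0.
  - by move=> y Uy _; apply: UV.
exists [set x | forall j, U j (x j)]; eexists; exists (fun x => h (x i)), (fun=> 1); split.
- by exists U => //; split; reflexivity.
- by apply: GenIn; exists i, h; split=> //; apply: rU.
- exact: GenConst.
- by split=> //; exact: oner_neq0.
- by move=> *; rewrite divr1.
Qed.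

Lemma morphism_to_product (C : fieldType) (I : finType) (Y : fspace C)
    (X : I -> fspace C) (f : Y -> product_space X) :
  is_swf Y -> (forall i, is_morphism (fun y => f y i)) -> is_morphism f.
Proof.
move=> nY mf; apply: morphism_to_chart_space => // _ _ [U oU [-> ->]].
have oV i : zopen ((fun y => f y i) @^-1` U i) by have [of_ _] := mf i; apply: of_.
have oW := swf_open_bigcap nY oV.
split=> // _ [i [h [rh ->]]]; have [_ rf] := mf i.
by apply: (swf_sub nY (oV i) _ (rf _ _ (oU i) rh)) => y; apply.
Qed.

(** * Open embeddings and products *)

(** Open embeddings described by the push-forward of open sets and of regular
    functions.  In this form, stability under composition is immediate and
    products can be treated generator by generator. *)
Record open_emb (C : fieldType) (X Y : fspace C) (f : X -> Y) : Prop := OpenEmb {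
  emb_morphism : is_morphism f;
  emb_inj : injective f;
  emb_open : forall V : set X, zopen V -> zopen (f @` V);
  emb_regular : forall (V : set X) (h : X -> C) (k : Y -> C),
    zopen V -> regular V h -> (forall x, V x -> k (f x) = h x) ->
    regular (f @` V) k }.

Lemma open_emb_id (C : fieldType) (X : fspace C) : is_swf X -> open_emb (@id X).
Proof.
move=> nX; split=> // [V|V h k oV rh kh]; rewrite image_id //.
exact: swf_ext rh kh.
Qed.

Lemma open_emb_comp (C : fieldType) (X Y Z : fspace C) (g : Y -> Z) (f : X -> Y) :
  open_emb g -> open_emb f -> open_emb (g \o f).
Proof.
move=> [mg ig og rg] [mf jf of_ rf].
split=> [|x y /ig /jf //|V oV|V h k oV rh kh].
- exact: morphism_comp.
- by rewrite -image_comp; apply/og/of_.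
- rewrite -image_comp; apply: (rg _ (k \o g)) => //; first exact: of_.
  exact: (rf _ h).
Qed.

Lemma open_emb_partial_inverse (C : fieldType) (X Y : fspace C) (f : X -> Y)
    (U : set Y) (fU : forall x, U (f x)) (r : subspace U -> X) :
  is_swf Y -> is_morphism f -> zopen U -> is_morphism r ->
  (forall x, r (exist _ (f x) (fU x)) = x) -> (forall y, f (r y) = sval y) ->
  open_emb f.
Proof.
move=> nY mf oU [or rr] fK rK.
have fV V y : zopen V -> (f @` V) y <-> exists Uy : U y, V (r (exist _ y Uy)).
  move=> oV; split=> [[x Vx <-]|[Uy Vy]]; first by exists (fU x); rewrite fK.
  by exists (r (exist _ y Uy)); rewrite // rK.
split=> // [x y fxy|V oV|V h k oV rh kh].
- rewrite -(fK x) -(fK y); congr r; exact: eq_exist.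
- have [W oW rW] := or V oV.
  rewrite [X in zopen X](_ : _ = U `&` W); first exact: swf_openI.
  apply/seteqP; split=> y.
    move=> /(fV V y oV)[Uy Vy]; split=> //.
    by have : (r @^-1` V) (exist _ y Uy) by []; rewrite rW.
  move=> [Uy Wy]; apply/fV => //; exists Uy.
  by have : (sval @^-1` W) (exist _ y Uy) by []; rewrite -rW.
- apply: (swf_regular_local nY) => y /(fV V y oV)[Uy Vy].
  have [W [g [oW rg Wy hg]]] := rr V h oV rh (exist _ y Uy) Vy.
  exists W, g; split=> // z /(fV V z oV)[Uz Vz] Wz.
  by rewrite -(hg (exist _ z Uz)) //= -kh // rK.
Qed.

Lemma open_emb_iso (C : fieldType) (X Y : fspace C) (f : X -> Y) :
  is_swf Y -> is_isomorphism f -> open_emb f.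
Proof.
move=> nY [mf [g [mg fK gK]]].
apply: (@open_emb_partial_inverse _ _ _ f setT (fun=> I) (g \o sval)) => //=.
- exact: swf_openT.
- exact: (morphism_comp mg (@morphism_sval _ _ _)).
Qed.

Lemma open_emb_is_open_embedding (C : fieldType) (X Y : fspace C) (f : X -> Y) :
  is_swf X -> is_swf Y -> open_emb f -> is_open_embedding f.
Proof.
move=> nX nY [mf jf of_ rf].
have fX x : range f (f x) by exists x.
pose g (x : X) : subspace (range f) := exist _ (f x) (fX x).
exists (range f), g; split=> //; first by apply/of_/swf_openT.
split; first exact: morphism_to_subspace.
have inv (y : subspace (range f)) : {x | f x = sval y}.
  by apply: cid; have [x _ <-] := svalP y; exists x.
pose r (y : subspace (range f)) := sval (inv y).
have rK y : f (r y) = sval y := svalP (inv y).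
have gK x : r (g x) = x by apply: jf; rewrite rK.
exists r; split=> //; last first.
  by case=> y fy; apply: eq_exist; rewrite rK.
have rV V : r @^-1` V = sval @^-1` (f @` V).
  apply/seteqP; split=> y /=; first by move=> Vy; exists (r y).
  by move=> [x Vx fxy]; rewrite (_ : r y = x) //; apply: jf; rewrite rK.
split=> [V oV|V h oV rh].
  by exists (f @` V); [exact: of_|rewrite rV].
pose k y := if pselect (range f y) is left fy then h (r (exist _ y fy)) else 0.
have kf x : k (f x) = h x.
  rewrite /k; case: pselect => [fx|[]//].
  by rewrite -[in RHS](gK x) /g (Prop_irrelevance fx (fX x)).
rewrite rV => y Vy; exists (f @` V), k; split=> //; first exact: of_.
  by apply: (rf _ h).
by move=> z _ _; rewrite -rK kf.
Qed.

Lemma product_isomorphism (C : fieldType) (I : finType) (X Y : I -> fspace C)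
    (f : forall i, X i -> Y i) :
  (forall i, is_swf (X i)) -> (forall i, is_swf (Y i)) ->
  (forall i, is_isomorphism (f i)) ->
  @is_isomorphism C (product_space X) (product_space Y) (fun x i => f i (x i)).
Proof.
move=> nX nY isof.
have inv i : {g : Y i -> X i | [/\ is_morphism g, cancel (f i) g & cancel g (f i)]}.
  by apply: cid; have [_] := isof i.
split.
  apply: morphism_to_product => [|i]; first exact: swf_product_space.
  by have [mf _] := isof i; apply: (morphism_comp mf (morphism_proj i nX)).
exists (fun y i => sval (inv i) (y i)); split.
- apply: morphism_to_product => [|i]; first exact: swf_product_space.
  by have [mg _ _] := svalP (inv i); apply: (morphism_comp mg (morphism_proj i nY)).
- by move=> x; apply: functional_extensionality_dep => i; have [_ -> _] := svalP (inv i).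
- by move=> x; apply: functional_extensionality_dep => i; have [_ _ ->] := svalP (inv i).
Qed.

(** On a box, generators push forward to generators, so every element of the
    generated algebra is the pull-back of one on the image box. *)
Lemma product_open_emb (C : fieldType) (I : finType) (X Y : I -> fspace C)
    (f : forall i, X i -> Y i) :
  (forall i, is_swf (X i)) -> (forall i, is_swf (Y i)) ->
  (forall i, open_emb (f i)) ->
  @open_emb C (product_space X) (product_space Y) (fun x i => f i (x i)).
Proof.
move=> nX nY ef; set F : product_space X -> product_space Y := fun x i => _.
have FE x i : F x i = f i (x i) by [].
have jF : injective F.
  move=> x y Fxy; apply: functional_extensionality_dep => i.
  by apply: (emb_inj (ef i)); rewrite -!FE Fxy.
have boxF (U : forall i, set (X i)) :
    F @` [set x | forall i, U i (x i)] = [set y | forall i, (f i @` U i) (y i)].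
  apply/seteqP; split=> [_ [x Ux <-] i|y Uy]; first by exists (x i).
  have inv i : {z | U i z & f i z = y i} by apply: cid2; apply: Uy.
  exists (fun i => s2val (inv i)) => [i|]; first exact: (s2valP (inv i)).
  by apply: functional_extensionality_dep => i; exact: (s2valP' (inv i)).
have push (U : forall i, set (X i)) (p : product_space X -> C) :
    (forall i, zopen (U i)) ->
    generated_algebra [set q | exists i (h : X i -> C),
       regular (U i) h /\ q = (fun x => h (x i))] p ->
    exists2 p', generated_algebra [set q | exists i (h : Y i -> C),
       regular (f i @` U i) h /\ q = (fun y => h (y i))] p' &
       forall x, p' (F x) = p x.
  move=> oU; elim=> [_ [i [h [rh ->]]]|c|p1 p2 _ [q1 G1 E1] _ [q2 G2 E2]|
                     p1 p2 _ [q1 G1 E1] _ [q2 G2 E2]].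
  (* The push-forward of h is extended by 0 outside the image of f i. *)
  - have ex y : exists c, forall x, f i x = y -> c = h x.
      have [[x <-]|no] := pselect (exists x, f i x = y).
        by exists (h x) => z /(emb_inj (ef i)) ->.
      by exists 0 => x fxy; case: no; exists x.
    pose k y := sval (cid (ex y)).
    have kE x : k (f i x) = h x by apply: (svalP (cid (ex (f i x)))).
    exists (fun y => k (y i)) => [|x]; last by rewrite FE.
    apply: GenIn; exists i, k; split=> //.
    by apply: (emb_regular (ef i) _ rh) => // x _; apply: kE.
  - by exists (fun=> c) => //; apply: GenConst.
  - by exists (fun y => q1 y + q2 y) => [|x]; rewrite ?E1 ?E2 //; apply: GenAdd.
  - by exists (fun y => q1 y * q2 y) => [|x]; rewrite ?E1 ?E2 //; apply: GenMul.
have obox (U : forall i, set (X i)) : (forall i, zopen (U i)) ->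
    forall i, zopen (f i @` U i).
  by move=> oU i; apply: (emb_open (ef i)).
split=> // [|V oV _ [x Vx <-]|V h k oV rh kh _ [x Vx <-]].
- apply: morphism_to_product => [|i]; first exact: swf_product_space.
  exact: (morphism_comp (emb_morphism (ef i)) (morphism_proj i nX)).
- have [W [G [q [[U oU [-> ->]] Gq Ux qx qV]]]] := oV x Vx.
  have [q' Gq' q'E] := push U q oU Gq.
  exists (F @` [set x | forall i, U i (x i)]); eexists; exists q'; split.
  + by exists (fun i => f i @` U i); [exact: obox|split; [exact: boxF|reflexivity]].
  + exact: Gq'.
  + by exists x.
  + by rewrite q'E.
  + by move=> _ [z Uz <-] qz; exists z => //; apply: qV; rewrite -?q'E.
- have [W [G [a [b [[U oU [-> ->]] Ga Gb [Ux bx] hab]]]]] := rh x Vx.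
  have [a' Ga' a'E] := push U a oU Ga.
  have [b' Gb' b'E] := push U b oU Gb.
  exists (F @` [set x | forall i, U i (x i)]); eexists; exists a', b'; split.
  + by exists (fun i => f i @` U i); [exact: obox|split; [exact: boxF|reflexivity]].
  + exact: Ga'.
  + exact: Gb'.
  + by split; [exists x|rewrite b'E].
  + move=> y Vy [z Uz zy]; rewrite -zy b'E => bz.
    have [z' Vz' z'y] := Vy; have /jF zz' : F z' = F z by rewrite z'y zy.
    by rewrite zz' in Vz'; rewrite a'E kh // hab.
Qed.

(** Binary products as products over the booleans. *)
Definition pair_family (C : fieldType) (X Y : fspace C) (b : bool) : fspace C :=
  if b then X else Y.

Definition pair_space (C : fieldType) (X Y : fspace C) : fspace C :=
  product_space (pair_family X Y).

Lemma swf_pair_family (C : fieldType) (X Y : fspace C) :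
  is_swf X -> is_swf Y -> forall b, is_swf (pair_family X Y b).
Proof. by move=> nX nY []. Qed.

Lemma split_last_isomorphism (C : fieldType) (X : nat -> fspace C) (l : nat) :
  (forall i, is_swf (X i)) ->
  exists f : product_space (fun i : 'I_l.+1 => X i) ->
             pair_space (product_space (fun i : 'I_l => X i)) (X l),
    is_isomorphism f.
Proof.
move=> nX; have nP n : is_swf (product_space (fun i : 'I_n => X i)).
  exact: swf_product_space.
have nB := swf_pair_family (nP l) (nX l).
pose f (x : product_space (fun i : 'I_l.+1 => X i)) :
    pair_space (product_space (fun i : 'I_l => X i)) (X l) :=
  fun b => match b return pair_family (product_space (fun i : 'I_l => X i)) (X l) b with
    | true => (fun i => x (widen_ord (leqnSn l) i)) : product_space (fun i : 'I_l => X i)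
    | false => x ord_max
    end.
have ordP (i : 'I_l.+1) : (exists j : 'I_l, i = widen_ord (leqnSn l) j) \/ i = ord_max.
  have [lt_il|le_li] := ltnP i l; first by left; exists (Ordinal lt_il); apply: val_inj.
  by right; apply: val_inj; apply/eqP; rewrite eqn_leq le_li -ltnS ltn_ord.
have ex (y : pair_space (product_space (fun i : 'I_l => X i)) (X l)) (i : 'I_l.+1) :
    exists z : X i, (forall (j : 'I_l) (e : i = widen_ord (leqnSn l) j),
                       ecast i (X i) e z = y true j) /\
                    (forall e : i = ord_max, ecast i (X i) e z = y false).
  have [[j ->]|->] := ordP i.
    exists (y true j); split=> [j' e|e].
      have jj' : j' = j by apply: val_inj; have /(congr1 val) := e.
      by case: j / jj' e => e; rewrite (Prop_irrelevance e erefl).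
    by have /(congr1 val)/= jl := e; exfalso; have := ltn_ord j; rewrite jl ltnn.
  exists (y false); split=> [j e|e]; last by rewrite (Prop_irrelevance e erefl).
  by have /(congr1 val)/= jl := e; exfalso; have := ltn_ord j; rewrite -jl ltnn.
pose g y : product_space (fun i : 'I_l.+1 => X i) := fun i => sval (cid (ex y i)).
have gw y j : g y (widen_ord (leqnSn l) j) = y true j.
  by rewrite /g; case: cid => z [/= /(_ j erefl)].
have gm y : g y ord_max = y false.
  by rewrite /g; case: cid => z [/= _ /(_ erefl)].
exists f; split.
  apply: morphism_to_product => [|[]]; first exact: nP.
    apply: morphism_to_product => [|i]; first exact: nP.
    exact: (@morphism_proj _ _ (fun i : 'I_l.+1 => X i) (widen_ord (leqnSn l) i)).
  exact: (@morphism_proj _ _ (fun i : 'I_l.+1 => X i) ord_max).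
exists g; split.
- apply: morphism_to_product => [|i]; first exact: swf_product_space.
  have [[j ->]|->] := ordP i.
    rewrite (funext (gw^~ j)).
    have mj := @morphism_proj _ _ (fun i : 'I_l => X i) j (fun i => nX i).
    exact: (morphism_comp mj (@morphism_proj _ _ _ true nB)).
  rewrite (funext gm).
  exact: (@morphism_proj _ _ _ false nB).
- move=> x; apply: functional_extensionality_dep => i.
  by have [[j ->]|->] := ordP i; rewrite ?gw ?gm.
- move=> y; apply: functional_extensionality_dep => -[]; last exact: gm.
  by apply: functional_extensionality_dep => j; apply: gw.
Qed.

(** * Regular matrix functions *)

Definition regular_mx (C : fieldType) (X : fspace C) m n (U : set X)
    (M : X -> 'M[C]_(m, n)) : Prop :=
  forall i j, regular U (fun x => M x i j).

Lemma swf_sum (C : fieldType) (X : fspace C) (U : set X) (I : Type) (r : seq I)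
    (P : pred I) (f : I -> X -> C) :
  is_swf X -> (forall i, P i -> regular U (f i)) ->
  regular U (fun x => \sum_(i <- r | P i) f i x).
Proof.
move=> nX rf; elim: r => [|i r IH].
  by under eq_fun do rewrite big_nil; apply: (swf_const nX).
under eq_fun do rewrite big_cons; case: (boolP (P i)) => // Pi.
by apply: (swf_add nX) => //; apply: rf.
Qed.

Lemma swf_prod (C : fieldType) (X : fspace C) (U : set X) (I : Type) (r : seq I)
    (P : pred I) (f : I -> X -> C) :
  is_swf X -> (forall i, P i -> regular U (f i)) ->
  regular U (fun x => \prod_(i <- r | P i) f i x).
Proof.
move=> nX rf; elim: r => [|i r IH].
  by under eq_fun do rewrite big_nil; apply: (swf_const nX).
under eq_fun do rewrite big_cons; case: (boolP (P i)) => // Pi.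
by apply: (swf_mul nX) => //; apply: rf.
Qed.

Lemma swf_inv_neq0 (C : fieldType) (X : fspace C) (U : set X) (f : X -> C) :
  is_swf X -> regular U f -> (forall x, U x -> f x != 0) ->
  regular U (fun x => (f x)^-1).
Proof.
move=> nX rf f0; have := swf_inv nX rf.
rewrite (_ : U `&` _ = U) //; apply/seteqP; split=> x /=; first by case.
by move=> Ux; split=> //; apply: f0.
Qed.

Lemma regular_mx_const (C : fieldType) (X : fspace C) m n (U : set X) (A : 'M[C]_(m, n)) :
  is_swf X -> regular_mx U (fun=> A).
Proof. by move=> nX i j; apply: swf_const. Qed.

Lemma regular_mx_mul (C : fieldType) (X : fspace C) m n p (U : set X)
    (M : X -> 'M[C]_(m, n)) (N : X -> 'M[C]_(n, p)) :
  is_swf X -> regular_mx U M -> regular_mx U N ->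
  regular_mx U (fun x => M x *m N x).
Proof.
move=> nX rM rN i j; under eq_fun do rewrite mxE.
by apply: swf_sum => // z _; apply: swf_mul.
Qed.

Lemma regular_det (C : fieldType) (X : fspace C) n (U : set X) (M : X -> 'M[C]_n) :
  is_swf X -> regular_mx U M -> regular U (fun x => \det (M x)).
Proof.
move=> nX rM; apply: swf_sum => // s _; apply: swf_mul => //; first exact: swf_const.
exact: swf_prod.
Qed.

Lemma regular_mx_inv (C : fieldType) (X : fspace C) n (U : set X) (M : X -> 'M[C]_n) :
  is_swf X -> zopen U -> regular_mx U M -> (forall x, U x -> M x \in unitmx) ->
  regular_mx U (fun x => invmx (M x)).
Proof.
move=> nX oU rM uM i j.
apply: (@swf_ext _ _ U U _ (fun x => (\det (M x))^-1 * cofactor (M x) j i)) => //.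
  apply: swf_mul => //.
    apply: swf_inv_neq0 => //; first exact: regular_det.
    by move=> x /uM; rewrite unitmxE unitfE.
  apply: swf_mul => //; first exact: swf_const.
  apply: regular_det => // a b; under eq_fun do rewrite !mxE; exact: rM.
by move=> x Ux; rewrite /invmx uM // !mxE.
Qed.

Lemma regular_trunc (C : fieldType) (X : fspace C) n (U : set X) (M : X -> 'M[C]_n) j :
  is_swf X -> regular_mx U M -> regular_mx U (fun x => trunc j (M x)).
Proof.
move=> nX rM a b; under eq_fun do rewrite mxE.
by case: ((a <= j)%N && (b <= j)%N); [exact: rM | exact: swf_const].
Qed.

Lemma regular_lu_lower (C : fieldType) (X : fspace C) n (U : set X) (M : X -> 'M[C]_n) :
  is_swf X -> zopen U -> regular_mx U M -> (forall x, U x -> has_lu (M x)) ->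
  regular_mx U (fun x => lu_lower (M x)).
Proof.
move=> nX oU rM luM; apply: regular_mx_mul => // i j.
under eq_fun do rewrite mxE; apply: regular_mx_inv => //; last by move=> x Ux; apply: luM.
exact: regular_trunc.
Qed.

Lemma open_has_lu (C : fieldType) (X : fspace C) n (M : X -> 'M[C]_n) :
  is_swf X -> regular_mx setT M -> zopen [set x | has_lu (M x)].
Proof.
move=> nX rM; rewrite (_ : [set x | _] =
    [set x | forall j, (setT `&` [set y | \det (trunc j (M y)) != 0]) x]).
  apply: swf_open_bigcap => // j; apply: swf_open_neq0 => //; first exact: swf_openT.
  by apply: regular_det => //; apply: regular_trunc.
apply/seteqP; split=> x /= lux j; have := lux j; rewrite unitmxE unitfE; first by split.
by case.
Qed.

(** * Flags of invertible matrices *)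

Lemma mulmx_col (C : fieldType) k (A B : 'M[C]_k) i : A *m col i B = col i (A *m B).
Proof. by rewrite !colE mulmxA. Qed.

Lemma flag_eq (C : fieldType) k (F F' : flag C k) :
  (forall j x, (x \in F j) = (x \in F' j)) -> F = F'.
Proof.
move=> FF'; have : flag_sub F = flag_sub F'.
  by apply/ffunP => j; apply/vspaceP => x; apply: FF'.
case: F F' {FF'} => [f p] [f' p'] /= E; case: f' / E p' => p'.
by rewrite (bool_irrelevance p p').
Qed.

(** The coordinates of [x] in the basis of columns of [g] are the entries of
    g^-1 x. *)
Lemma mem_columns_flag (C : fieldType) k (g : 'M[C]_k) (fg : free [tuple col i g | i < k])
    (j : 'I_k.+1) (x : 'cV[C]_k) :
  g \in unitmx ->
  x \in basis_flag fg j <-> forall m : 'I_k, (j <= m)%N -> (invmx g *m x) m 0 = 0.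
Proof.
move=> ug; rewrite /= ffunE; set b := [tuple col i g | i < k].
have nth_b (m : 'I_k) : nth 0 b m = col m g by rewrite -tnth_nth tnth_mktuple.
pose D : 'M[C]_k := diag_mx (\row_m (j <= m)%:R).
pose f := linfun (mulmx (D *m invmx g) : 'cV[C]_k -> 'cV[C]_k).
have fE y : y \in lker f <-> forall m : 'I_k, (j <= m)%N -> (invmx g *m y) m 0 = 0.
  rewrite memv_ker lfunE /= -mulmxA; split=> [/eqP/colP f0 m jm|f0].
    by have := f0 m; rewrite mul_diag_mx !mxE jm mul1r.
  apply/eqP/colP => m; rewrite mul_diag_mx !mxE; case: leqP => jm; last by rewrite mul0r.
  by have := f0 m jm; rewrite mxE => ->; rewrite mulr0.
split=> [xb|x0].
  apply/fE; apply: (subvP _ _ xb); apply/span_subvP => y /(nthP 0)[m].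
  rewrite size_take size_tuple card_ord => lt_m; have [lt_mj lt_mk] : (m < j)%N /\ (m < k)%N.
    by have := ltn_ord j; move: lt_m; case: (ltnP j k); lia.
  rewrite nth_take // (nth_b (Ordinal lt_mk)) => <-; apply/fE => i ji.
  rewrite mulmx_col mulVmx // !mxE; case: eqVneq => // im.
  by move: lt_mj; rewrite ltnNge; have /(congr1 val)/= <- := im; rewrite ji.
have -> : x = \sum_m (invmx g *m x) m 0 *: col m g.
  rewrite -[x in LHS](mulKVmx ug); apply/colP => i; rewrite mxE summxE.
  by apply: eq_bigr => m _; rewrite !mxE mulrC.
apply: memv_suml => m _; have [jm|mj] := leqP j m; first by rewrite x0 // scale0r mem0v.
apply/memvZ/memv_span; rewrite -nth_b -(nth_take _ mj) mem_nth //.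
by rewrite size_take size_tuple ?card_ord; case: (ltnP j k) => // _; exact: ltn_ord.
Qed.

Definition GL_point (C : fieldType) k (M : 'M[C]_k) (uM : M \in unitmx) : GL_space C k :=
  exist _ M uM.

(** The flag of the columns of [M], made total in [M] so that families of
    matrices need not carry invertibility proofs; the value at singular matrices
    is arbitrary. *)
Definition flag_of_mx (C : fieldType) k (M : 'M[C]_k) : flag C k :=
  if pselect (M \in unitmx) is left uM then flag_of_GL (GL_point uM)
  else std_flag C k.

Lemma flag_of_GL_E (C : fieldType) k (g : GL_space C k) : flag_of_GL g = flag_of_mx (sval g).
Proof.
case: g => M uM; rewrite /flag_of_mx; case: pselect => [uM'|[]//=].
by congr flag_of_GL; apply: eq_exist.
Qed.

Lemma mem_flag_of_mx (C : fieldType) k (M : 'M[C]_k) (j : 'I_k.+1) (x : 'cV[C]_k) :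
  M \in unitmx ->
  x \in flag_of_mx M j <-> forall m : 'I_k, (j <= m)%N -> (invmx M *m x) m 0 = 0.
Proof.
by move=> uM; rewrite -[M]/(sval (GL_point uM)) -flag_of_GL_E; apply: mem_columns_flag.
Qed.

Lemma flag_of_mx_borel (C : fieldType) k (M b : 'M[C]_k) :
  M \in unitmx -> borel b -> flag_of_mx (M *m b) = flag_of_mx M.
Proof.
move=> uM bb; apply: flag_eq => j x; have [ub sb] := bb; have [_ sb'] := borel_inv bb.
have uMb : M *m b \in unitmx by rewrite unitmx_mul uM.
have invE := invmx_mul uM ub.
have vanish (c : 'M[C]_k) (y : 'cV[C]_k) : supported (@up k) c ->
    (forall m : 'I_k, (j <= m)%N -> y m 0 = 0) ->
    forall m : 'I_k, (j <= m)%N -> (c *m y) m 0 = 0.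
  move=> sc y0 m jm; rewrite mxE big1 // => z _.
  have [jz|zj] := leqP j z; first by rewrite y0 // mulr0.
  have lt_zm := leq_trans zj jm.
  have mz : m != z by rewrite neq_ltn lt_zm orbT.
  by rewrite sc ?mul0r // /up -leqNgt ltnW.
apply/idP/idP => /mem_flag_of_mx xF; apply/mem_flag_of_mx => //.
  move=> m jm; rewrite -[invmx M *m x](mulKVmx ub) (mulmxA (invmx b)) -invE.
  by apply: vanish => //; apply: xF.
rewrite invE => m jm; rewrite -mulmxA; apply: vanish => //; exact: xF.
Qed.

(** Column j of M' lies in the span of the columns 0..j of M. *)
Lemma flag_of_mx_eqP (C : fieldType) k (M M' : 'M[C]_k) :
  M \in unitmx -> M' \in unitmx -> flag_of_mx M = flag_of_mx M' ->
  exists2 b, borel b & M' = M *m b.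
Proof.
move=> uM uM' MM'; exists (invmx M *m M'); last by rewrite mulKVmx.
split=> [|m j mj]; first by rewrite unitmx_mul unitmx_inv uM.
rewrite /up -leqNgt leq_eqVlt eq_sym (inj_eq val_inj) (negPf mj) /= => jm.
have : col j M' \in flag_of_mx M' (inord j.+1).
  apply/mem_flag_of_mx => // i; rewrite inordK ?ltnS // => ji.
  by rewrite mulmx_col mulVmx // !mxE -(inj_eq val_inj) gtn_eqF.
rewrite -MM' => /mem_flag_of_mx => /(_ uM m); rewrite inordK ?ltnS // => /(_ jm).
by rewrite mulmx_col mxE.
Qed.

Lemma coord_flagE (C : fieldType) k (w : 'S_k) : coord_flag C w = flag_of_mx (permmx C w).
Proof.
rewrite -[permmx C w]/(sval (GL_point (permmx_unit C w))) -flag_of_GL_E.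
apply: flag_eq => j x; rewrite /= !ffunE; congr (_ \in <<take _ _>>%VS).
apply: eq_map => i.
by apply/colP => a; rewrite mxE [RHS]mxE permmxE eqxx andbT.
Qed.

Lemma flag_act_of_mx (C : fieldType) k (g : GL_space C k) (M : 'M[C]_k) :
  M \in unitmx -> flag_act g (flag_of_mx M) = flag_of_mx (sval g *m M).
Proof.
move=> uM; have ug : sval g \in unitmx := svalP g.
have ugM : sval g *m M \in unitmx by rewrite unitmx_mul ug.
have invE := invmx_mul ug uM.
apply: flag_eq => j x; rewrite [in LHS]/= ffunE; apply/idP/idP.
  move=> /memv_imgP[y /mem_flag_of_mx yM ->]; apply/mem_flag_of_mx => // m jm.
  by rewrite lfunE /= invE -mulmxA mulKmx // yM.
move=> /mem_flag_of_mx xF; apply/memv_imgP; exists (invmx (sval g) *m x).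
  by apply/mem_flag_of_mx => // m jm; rewrite mulmxA -invE; apply: xF.
by rewrite lfunE /= mulKVmx.
Qed.

(** * Open Richardson varieties as intersections of cells *)

Definition in_richardson (C : fieldType) k (v w : 'S_k) (M : 'M[C]_k) : Prop :=
  bruhat_cell (@up k) w M /\ bruhat_cell (@low k) v M.

Lemma bruhat_cell_unit (C : fieldType) k (P : rel 'I_k) (v : 'S_k) (M : 'M[C]_k) :
  strict_order P -> bruhat_cell P v M -> M \in unitmx.
Proof.
by move=> sP [n [b [/(unipotent_unit sP) un [ub _] ->]]]; rewrite !unitmx_mul un permmx_unit.
Qed.

Lemma reversal_supported (C : fieldType) k (A : 'M[C]_k) :
  supported (@up k) A <->
  supported (@low k) (permmx C (longest_perm k) *m A *m permmx C (longest_perm k)^-1%g).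
Proof.
have lE (x : 'I_k) : longest_perm k x = rev_ord x by rewrite permE.
have lV (x : 'I_k) : (longest_perm k)^-1%g x = rev_ord x.
  by apply: (@perm_inj _ (longest_perm k)); rewrite permKV lE rev_ordK.
split=> sA x y xy.
  rewrite /low -leqNgt => le_xy; rewrite mul_permmxE permmx_mulE !lV sA //.
    by rewrite (inj_eq rev_ord_inj).
  by rewrite /up /= -leqNgt leq_sub2l.
rewrite /up -leqNgt => le_yx; have := sA (rev_ord x) (rev_ord y).
rewrite mul_permmxE permmx_mulE !lV !rev_ordK (inj_eq rev_ord_inj) => -> //.
by rewrite /low /= -leqNgt leq_sub2l.
Qed.

(** If g fixes the standard flag, then g is in B, and gM = wB means that M is in
    BwB. *)
Lemma relative_position_std (C : fieldType) k (w : 'S_k) (M : 'M[C]_k) :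
  M \in unitmx ->
  relative_position (std_flag C k) w (flag_of_mx M) <-> bruhat_cell (@up k) w M.
Proof.
move=> uM; have stdE : std_flag C k = flag_of_mx 1%:M by rewrite /std_flag coord_flagE permmx1.
split=> [[g []]|[n [b [un bb ME]]]].
  have ug : sval g \in unitmx := svalP g.
  rewrite stdE !flag_act_of_mx ?unitmx1 // coord_flagE mulmx1 => g1 gM.
  have [//|//|b bb gE] := flag_of_mx_eqP _ _ (esym g1); first exact: unitmx1.
  have [||b' bb' gM'] := flag_of_mx_eqP _ _ (esym gM).
  - exact: permmx_unit.
  - by rewrite unitmx_mul ug.
  rewrite mul1mx in gE; rewrite -(mulKmx ug M) gM' mulmxA.
  have [ubg sbg] : borel (invmx (sval g)) by rewrite gE; apply: borel_inv.
  exact: bruhat_cell_supported (@strict_up k) sbg ubg bb'.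
have unn := unipotent_unit (@strict_up k) un.
have uni : invmx n \in unitmx by rewrite unitmx_inv.
exists (GL_point uni); rewrite stdE !flag_act_of_mx ?unitmx1 // coord_flagE /= mulmx1.
split.
  rewrite -[invmx n]mul1mx flag_of_mx_borel ?unitmx1 //.
  exact/borel_inv/borel_unipotent.
by rewrite ME -!mulmxA mulKmx // flag_of_mx_borel // permmx_unit.
Qed.

(** If g sends the flag of M to the standard one and the antidominant flag to that
    of v^-1 w_0, then gM is in B and g^-1 is in w_0 B w_0 v = B_- v. *)
Lemma relative_position_ant (C : fieldType) k (v : 'S_k) (M : 'M[C]_k) :
  M \in unitmx ->
  relative_position (flag_of_mx M) (longest_perm k * v^-1)%g (ant_flag C k) <->
  bruhat_cell (@low k) v M.
Proof.
move=> uM; set w0 := longest_perm k.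
have stdE : std_flag C k = flag_of_mx 1%:M by rewrite /std_flag coord_flagE permmx1.
have w0V : (w0^-1 = w0)%g.
  by apply/permP => x; apply: (@perm_inj _ w0); rewrite permKV !permE rev_ordK.
have W0K : permmx C w0 *m permmx C w0 = 1%:M by rewrite -{1}w0V permmxM mulgV permmx1.
split=> [[g []]|[n [b [un bb ME]]]].
  have ug : sval g \in unitmx := svalP g.
  rewrite stdE /ant_flag !coord_flagE !flag_act_of_mx ?permmx_unit // => gM gw.
  have [//|//|b bb gME] := flag_of_mx_eqP _ _ (esym gM); first exact: unitmx1.
    by rewrite unitmx_mul ug.
  have [||b' bb' gwE] := flag_of_mx_eqP _ _ (esym gw).
  - exact: permmx_unit.
  - by rewrite unitmx_mul ug permmx_unit.
  rewrite mul1mx in gME; have [ub' _] := bb'.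
  pose n := permmx C w0 *m invmx b' *m permmx C w0.
  have gVE : invmx (sval g) = n *m permmx C v.
    apply: (can_inj (mulKmx ug)); rewrite mulmxV // /n !mulmxA gwE -permmxM.
    rewrite -!mulmxA (mulmxA b') mulmxV // mul1mx (mulmxA (permmx C w0)) W0K mul1mx.
    by rewrite permmxM mulgV permmx1.
  rewrite -(mulKmx ug M) gME gVE.
  apply: bruhat_cell_supported => //; first exact: strict_low.
    rewrite /n -{2}w0V; apply/reversal_supported.
    by have [] := borel_inv bb'.
  by rewrite !unitmx_mul !permmx_unit unitmx_inv ub'.
have unn := unipotent_unit (@strict_low k) un.
have ug : permmx C v^-1%g *m invmx n \in unitmx by rewrite unitmx_mul permmx_unit unitmx_inv.
have [ub _] := bb.
exists (GL_point ug); rewrite stdE /ant_flag !coord_flagE !flag_act_of_mx ?permmx_unit //=.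
have -> : permmx C v^-1%g *m invmx n *m M = 1%:M *m b.
  by rewrite ME -!mulmxA mulKmx // permmxK mul1mx.
rewrite flag_of_mx_borel ?unitmx1 //; split=> //.
pose b' := permmx C w0 *m invmx n *m permmx C w0.
have -> : permmx C v^-1%g *m invmx n *m permmx C w0 = permmx C (w0 * v^-1)%g *m b'.
  by rewrite -permmxM /b' -!mulmxA (mulmxA (permmx C w0) (permmx C w0)) W0K mul1mx.
apply: flag_of_mx_borel; first exact: permmx_unit.
split; first by rewrite !unitmx_mul !permmx_unit unitmx_inv unn.
apply/reversal_supported; rewrite -/w0 w0V /b' -!mulmxA W0K mulmx1.
rewrite mulmxA W0K mul1mx; apply: unipotent_supported.
exact: unipotent_inv (@strict_low k) un.
Qed.

Lemma richardsonP (C : fieldType) k (v w : 'S_k) (F : flag C k) :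
  relative_position (std_flag C k) w F /\
  relative_position F (longest_perm k * v^-1)%g (ant_flag C k) <->
  exists2 M, in_richardson v w M & F = flag_of_mx M.
Proof.
split=> [[stdF Fant]|[M [wM vM] ->]]; last first.
  have uM := bruhat_cell_unit (@strict_up k) wM.
  by split; [apply/relative_position_std|apply/relative_position_ant].
have [g [gstd gF]] := stdF; have ug : sval g \in unitmx := svalP g.
have ugV : invmx (sval g) \in unitmx by rewrite unitmx_inv.
have FE : F = flag_of_mx (invmx (sval g) *m permmx C w).
  have <- : flag_act (GL_point ugV) (flag_act g F) = F.
    apply: flag_eq => j x; rewrite [in LHS]/= ffunE; apply/idP/idP.
      move=> /memv_imgP[y + ->]; rewrite /= ffunE lfunE /= => /memv_imgP[z zF ->].
      by rewrite lfunE /= mulKmx.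
    move=> xF; apply/memv_imgP; exists (sval g *m x); last by rewrite lfunE /= mulKmx.
    rewrite /= ffunE; apply/memv_imgP; exists x => //; by rewrite lfunE.
  by rewrite gF coord_flagE flag_act_of_mx ?permmx_unit.
have uM : invmx (sval g) *m permmx C w \in unitmx by rewrite unitmx_mul ugV permmx_unit.
exists (invmx (sval g) *m permmx C w) => //; split.
  by apply/relative_position_std; rewrite -?FE.
by apply/relative_position_ant; rewrite -?FE.
Qed.

Definition flag_chart (C : fieldType) k (v : 'S_k) : set (flag_space C k) :=
  [set F | exists2 M, M \in unitmx /\ in_chart v M & F = flag_of_mx M].

(** Any representative [M] may be used, by [flag_coordE]; outside the chart the
    value is a dummy. *)
Definition flag_coord (C : fieldType) k (v : 'S_k) (F : flag_space C k) : 'M[C]_k :=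
  if pselect (exists M, (M \in unitmx /\ in_chart v M) /\ F = flag_of_mx M) is left h
  then chart_coord v (sval (cid h)) else 0.

Lemma flag_coordE (C : fieldType) k (v : 'S_k) (M : 'M[C]_k) :
  M \in unitmx -> in_chart v M -> flag_coord v (flag_of_mx M) = chart_coord v M.
Proof.
move=> uM cM; rewrite /flag_coord; case: pselect => [h|[]]; last by exists M.
case: cid => M' /= [[uM' cM'] MM'].
have [b bb M'E] := flag_of_mx_eqP uM uM' MM'.
have [ug [b' bb' ME]] := in_chart_decomp cM.
rewrite M'E {1}ME -mulmxA; apply: (chart_coordP ug _).2.
exact: borel_mul.
Qed.

Lemma flag_coordP (C : fieldType) k (v : 'S_k) (F : flag_space C k) :
  flag_chart v F ->
  unipotent (cell_order v) (flag_coord v F) /\ F = flag_of_mx (flag_coord v F *m permmx C v).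
Proof.
move=> [M [uM cM] ->]; rewrite flag_coordE //.
have [ug [b' bb' ME]] := in_chart_decomp cM; split=> //.
rewrite {1}ME flag_of_mx_borel // unitmx_mul permmx_unit andbT.
exact: unipotent_unit (strict_cell_order v) ug.
Qed.

Lemma flag_coord_unipotent (C : fieldType) k (v : 'S_k) (g : 'M[C]_k) :
  unipotent (cell_order v) g ->
  flag_chart v (flag_of_mx (g *m permmx C v)) /\ flag_coord v (flag_of_mx (g *m permmx C v)) = g.
Proof.
move=> ug; have [cg gE] := chart_coordP ug (borel1 C k); rewrite mulmx1 in cg gE.
have u : g *m permmx C v \in unitmx.
  by rewrite unitmx_mul permmx_unit andbT (unipotent_unit (strict_cell_order v)).
by split; [exists (g *m permmx C v)|rewrite flag_coordE].
Qed.

Lemma bruhat_cell_flag (C : fieldType) k (P : rel 'I_k) (z : 'S_k) (M : 'M[C]_k) :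
  strict_order P -> bruhat_cell P z M ->
  flag_chart z (flag_of_mx M) /\ unipotent P (flag_coord z (flag_of_mx M)).
Proof.
move=> sP zM; have uM := bruhat_cell_unit sP zM; have [cM uP] := bruhat_cell_chart sP zM.
by split; [exists M | rewrite flag_coordE].
Qed.

Lemma swf_GL (C : fieldType) k : is_swf (GL_space C k).
Proof. exact/swf_subspace/swf_matrix_space. Qed.

Lemma swf_flag_space (C : fieldType) k : is_swf (flag_space C k).
Proof. exact/swf_quotient_space/swf_GL. Qed.

Lemma swf_richardson (C : fieldType) k (v w : 'S_k) : is_swf (richardson C v w).
Proof. exact/swf_subspace/swf_flag_space. Qed.

Lemma regular_entry_GL (C : fieldType) k :
  regular_mx setT (fun g : GL_space C k => sval g).
Proof.
move=> i j; have [_ rs] := @morphism_sval C (matrix_space C k k) [set g | g \in unitmx].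
apply: (rs setT (fun A => A i j)); first exact: (swf_openT (swf_matrix_space C k k)).
move=> A _; exists setT; eexists; exists (fun B => B i j), (fun=> 1); split.
- by split; reflexivity.
- by apply: GenIn; exists i, j.
- exact: GenConst.
- by split=> //; exact: oner_neq0.
- by move=> *; rewrite divr1.
Qed.

Lemma flag_chart_pi (C : fieldType) k (v : 'S_k) :
  @flag_of_GL C k @^-1` flag_chart v = [set g | in_chart v (sval g)].
Proof.
apply/seteqP; split=> g /=; rewrite flag_of_GL_E; last first.
  by move=> cg; exists (sval g) => //; split=> //; exact: (svalP g).
move=> [M [uM cM] /esym E]; have [b bb ->] := flag_of_mx_eqP uM (svalP g) E.
have [ug [b' bb' ->]] := in_chart_decomp cM.
by rewrite -mulmxA; apply: (chart_coordP ug _).1; apply: borel_mul.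
Qed.

Lemma regular_permmx_mul (C : fieldType) k (v : 'S_k) :
  regular_mx setT (fun g : GL_space C k => permmx C v^-1%g *m sval g).
Proof.
apply: regular_mx_mul (swf_GL C k) _ (@regular_entry_GL C k).
exact: regular_mx_const (swf_GL C k).
Qed.

Lemma open_flag_chart (C : fieldType) k (v : 'S_k) :
  @zopen C (flag_space C k) (flag_chart v).
Proof.
change (@zopen C (GL_space C k) (@flag_of_GL C k @^-1` flag_chart v)).
by rewrite flag_chart_pi; apply: (open_has_lu (swf_GL C k)); apply: regular_permmx_mul.
Qed.

Lemma regular_flag_coord (C : fieldType) k (v : 'S_k) :
  @regular_mx C (flag_space C k) _ _ (flag_chart v) (flag_coord v).
Proof.
move=> i j; have nG := swf_GL C k.
have oV : zopen [set g : GL_space C k | in_chart v (sval g)].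
  by apply: (open_has_lu nG); apply: regular_permmx_mul.
change (@regular C (GL_space C k) (@flag_of_GL C k @^-1` flag_chart v)
  (fun g => flag_coord v (flag_of_GL g) i j)).
rewrite flag_chart_pi.
apply: (@swf_ext _ _ _ [set g : GL_space C k | in_chart v (sval g)] _
  (fun g => chart_coord v (sval g) i j)) => // [|g cg]; last first.
  by rewrite /= flag_of_GL_E flag_coordE //; exact: (svalP g).
apply: regular_mx_mul => //; last exact: regular_mx_const.
apply: regular_mx_mul => //; first exact: regular_mx_const.
apply: regular_lu_lower => // a b.
by apply: (swf_sub nG (swf_openT nG)); last exact: regular_permmx_mul.
Qed.

Lemma morphism_flag_of_mx (C : fieldType) (X : fspace C) k (M : X -> 'M[C]_k) :
  is_swf X -> regular_mx setT M -> (forall x, M x \in unitmx) ->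
  @is_morphism C X (flag_space C k) (fun x => flag_of_mx (M x)).
Proof.
move=> nX rM uM.
rewrite (_ : (fun x => _) = fun x => flag_of_GL (GL_point (uM x))); last first.
  by apply: funext => x; rewrite flag_of_GL_E.
apply: (morphism_comp (@morphism_quotient _ (GL_space C k) _ (@flag_of_GL C k))).
apply: (@morphism_to_subspace _ X (matrix_space C k k)) => //.
exact: morphism_to_matrix_space.
Qed.

Lemma regular_coord_comp (C : fieldType) (X : fspace C) k (v : 'S_k)
    (f : X -> flag_space C k) :
  is_swf X -> is_morphism f -> (forall x, flag_chart v (f x)) ->
  regular_mx setT (fun x => flag_coord v (f x)).
Proof.
move=> nX [of_ rf] cf i j; have := rf _ _ (@open_flag_chart C k v) (@regular_flag_coord C k v i j).
by rewrite (_ : f @^-1` _ = setT) //; apply/seteqP; split=> x // _; apply: cf.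
Qed.

Lemma morphism_point (C : fieldType) k (v w : 'S_k) :
  is_morphism (fun x : richardson C v w => sval x : flag_space C k).
Proof. exact: morphism_sval. Qed.

Definition richardson_point (C : fieldType) k (v w : 'S_k) (M : 'M[C]_k)
    (rM : in_richardson v w M) : richardson C v w :=
  exist _ (flag_of_mx M) ((richardsonP v w (flag_of_mx M)).2 (ex_intro2 _ _ M rM erefl)).

Lemma richardson_rep (C : fieldType) k (v w : 'S_k) (F : richardson C v w) :
  exists2 M, in_richardson v w M & sval F = flag_of_mx M.
Proof. exact/richardsonP/(svalP F). Qed.

Lemma richardson_coord (C : fieldType) k (z v w : 'S_k) (F : richardson C v w) :
  flag_chart z (sval F) -> in_richardson v w (flag_coord z (sval F) *m permmx C z).
Proof.
have [M [wM vM] FE] := richardson_rep F; have uM := bruhat_cell_unit (@strict_up k) wM.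
rewrite FE => cF; have [ug gE] := flag_coordP cF.
have [|b bb ME] := flag_of_mx_eqP _ uM (esym gE).
  by rewrite unitmx_mul permmx_unit andbT (unipotent_unit (strict_cell_order z)).
by split; apply/(bruhat_cell_borelP _ _ _ bb); rewrite -ME.
Qed.

Lemma richardson_top (C : fieldType) k (v w : 'S_k) (F : richardson C v w) :
  flag_chart w (sval F) /\ unipotent (@up k) (flag_coord w (sval F)).
Proof.
have [M [wM vM] ->] := richardson_rep F.
exact: bruhat_cell_flag (@strict_up k) wM.
Qed.

Lemma richardson_bottom (C : fieldType) k (v w : 'S_k) (F : richardson C v w) :
  flag_chart v (sval F) /\ unipotent (@low k) (flag_coord v (sval F)).
Proof.
have [M [wM vM] ->] := richardson_rep F.
exact: bruhat_cell_flag (@strict_low k) vM.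
Qed.

(** * Splicing Richardson varieties *)

(** The product is n b with n in U_-, which preserves B_-uB, and also n' a with
    n' in U, which preserves BwB. *)
Lemma in_richardson_splice_mul (C : fieldType) k (u v w : 'S_k) (b a : 'M[C]_k) :
  unipotent (cell_order v) b -> unipotent (cell_order v) a ->
  in_richardson u v (b *m permmx C v) -> in_richardson v w (a *m permmx C v) ->
  in_richardson u w (splice_mul b a *m permmx C v).
Proof.
move=> ub ua [_ uM] [wM _].
have [[n un bE] [n' un' aE]] := splice_mul_factor (strict_cell_order v) ub ua.
split; [rewrite aE|rewrite bE]; rewrite -mulmxA; apply: bruhat_cell_mul => //.
  exact: strict_up.
exact: strict_low.
Qed.

Lemma in_richardson_splice (C : fieldType) k (u v w : 'S_k) (g : 'M[C]_k) :
  unipotent (cell_order v) g -> in_richardson u w (g *m permmx C v) ->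
  in_richardson u v (splice_left g *m permmx C v) /\
  in_richardson v w (splice_right g *m permmx C v).
Proof.
move=> ug [wM uM]; have sc := strict_cell_order v.
have [_ upb] := splice_leftP sc ug; have [_ lowa] := splice_rightP sc ug.
have [[n un bE] [n' un' aE]] := splice_factor sc ug.
have [nu nu'] := (unipotent_unit (@strict_low k) un, unipotent_unit (@strict_up k) un').
split; split; try exact: bruhat_cell_self.
- rewrite (_ : splice_left g = invmx n *m g); last by rewrite [in RHS]bE mulKmx.
  rewrite -mulmxA; apply: bruhat_cell_mul => //; first exact: strict_low.
  exact: unipotent_inv (@strict_low k) un.
- rewrite (_ : splice_right g = invmx n' *m g); last by rewrite [in RHS]aE mulKmx.
  rewrite -mulmxA; apply: bruhat_cell_mul => //; first exact: strict_up.
  exact: unipotent_inv (@strict_up k) un'.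
Qed.

Lemma regular_splice_mul (C : fieldType) (X : fspace C) k (P : rel 'I_k)
    (b a : X -> 'M[C]_k) :
  is_swf X -> strict_order P ->
  (forall x, unipotent P (b x)) -> (forall x, unipotent P (a x)) ->
  regular_mx setT b -> regular_mx setT a ->
  regular_mx setT (fun x => splice_mul (b x) (a x)).
Proof.
move=> nX sP ub ua rb ra; have oT := swf_openT nX.
have uh x : unipotent P (b x *m invmx (a x)).
  by apply: unipotent_mul => //; apply: unipotent_inv.
apply: regular_mx_mul => //; apply: regular_mx_inv => //; last first.
  by move=> x _; apply/(unipotent_unit sP)/lu_lower_pattern.
apply: regular_lu_lower => //; last by move=> x _; apply: unipotent_has_lu (uh x).
apply: regular_mx_mul => //; apply: regular_mx_inv => // x _.
exact: unipotent_unit (ua x).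
Qed.

Lemma regular_splice_left (C : fieldType) (X : fspace C) k (P : rel 'I_k)
    (g : X -> 'M[C]_k) :
  is_swf X -> strict_order P -> (forall x, unipotent P (g x)) ->
  regular_mx setT g -> regular_mx setT (fun x => splice_left (g x)).
Proof.
move=> nX sP ug rg; have oT := swf_openT nX.
apply: regular_mx_mul => //; apply: regular_mx_inv => //; last first.
  by move=> x _; apply/(unipotent_unit sP)/lu_lower_pattern.
by apply: regular_lu_lower => // x _; apply: unipotent_has_lu (ug x).
Qed.

Lemma regular_splice_right (C : fieldType) (X : fspace C) k (P : rel 'I_k)
    (g : X -> 'M[C]_k) :
  is_swf X -> strict_order P -> (forall x, unipotent P (g x)) ->
  regular_mx setT g -> regular_mx setT (fun x => splice_right (g x)).
Proof.
move=> nX sP ug rg; have oT := swf_openT nX.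
have uV x : unipotent P (invmx (g x)) by apply: unipotent_inv.
apply: regular_mx_inv => //; last first.
  by move=> x _; apply/(unipotent_unit sP)/lu_lower_pattern.
apply: regular_lu_lower => //; last by move=> x _; apply: unipotent_has_lu (uV x).
by apply: regular_mx_inv => // x _; apply: unipotent_unit (ug x).
Qed.

Lemma morphism_to_richardson (C : fieldType) (X : fspace C) k (v w z : 'S_k)
    (f : X -> richardson C v w) (g : X -> 'M[C]_k) :
  is_swf X -> regular_mx setT g -> (forall x, unipotent (cell_order z) (g x)) ->
  (forall x, sval (f x) = flag_of_mx (g x *m permmx C z)) -> is_morphism f.
Proof.
move=> nX rg ug fE; apply: (@morphism_to_subspace _ X (flag_space C k)) => //.
rewrite (_ : (fun x => _) = fun x => flag_of_mx (g x *m permmx C z)); last exact: funext.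
apply: morphism_flag_of_mx => //; first by apply: regular_mx_mul => //; apply: regular_mx_const.
by move=> x; rewrite unitmx_mul permmx_unit andbT (unipotent_unit (strict_cell_order z)).
Qed.

Lemma subspace_eq (C : fieldType) (X : fspace C) (A : set X) (x y : subspace A) :
  sval x = sval y -> x = y.
Proof. by case: x y => [x px] [y py] /= xy; apply: eq_exist. Qed.

(** Points of R(u,v) and of R(v,w) both have coordinates in vU_-v^-1, upper
    unitriangular for the former and lower unitriangular for the latter.  The
    map splices these coordinates, its image is the part of R(u,w) in the chart
    at [v], and the inverse reads off the two factors. *)
Theorem splice_open_emb (C : fieldType) k (u v w : 'S_k) :
  exists m : pair_space (richardson C u v) (richardson C v w) -> richardson C u w,
    open_emb m.
Proof.
have sc := strict_cell_order v.
have nR (a b : 'S_k) : is_swf (richardson C a b) by apply: swf_richardson.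
have nf := swf_pair_family (nR u v) (nR v w).
have nP : is_swf (pair_space (richardson C u v) (richardson C v w)).
  exact: swf_product_space.
pose Puvw := pair_space (richardson C u v) (richardson C v w).
pose left_coord (p : Puvw) : 'M[C]_k :=
  flag_coord v (sval (p true : richardson C u v)).
pose right_coord (p : Puvw) : 'M[C]_k :=
  flag_coord v (sval (p false : richardson C v w)).
have cl (p : Puvw) := (@richardson_top C k u v (p true)).1.
have cr (p : Puvw) := (@richardson_bottom C k v w (p false)).1.
have upl (p : Puvw) := (@richardson_top C k u v (p true)).2 :
  unipotent (@up k) (left_coord p).
have lor (p : Puvw) := (@richardson_bottom C k v w (p false)).2 :
  unipotent (@low k) (right_coord p).
have ul (p : Puvw) := (flag_coordP (cl p)).1 :
  unipotent (cell_order v) (left_coord p).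
have ur (p : Puvw) := (flag_coordP (cr p)).1 :
  unipotent (cell_order v) (right_coord p).
have rM p : in_richardson u w (splice_mul (left_coord p) (right_coord p) *m permmx C v).
  by apply: in_richardson_splice_mul (ul p) (ur p) _ _; apply: richardson_coord.
pose m p : richardson C u w := richardson_point (rM p).
pose U : set (richardson C u w) := [set F | flag_chart v (sval F)].
have um p : unipotent (cell_order v) (splice_mul (left_coord p) (right_coord p)).
  exact: splice_mulP.
have mU p : U (m p) by have [] := flag_coord_unipotent (um p).
pose coord (F : subspace U) : 'M[C]_k := flag_coord v (sval (sval F)).
have ug (F : subspace U) : unipotent (cell_order v) (coord F).
  by have [] := flag_coordP (svalP F).
have rg (F : subspace U) := in_richardson_splice (ug F) (richardson_coord (svalP F)).
pose r (F : subspace U) : pair_space (richardson C u v) (richardson C v w) :=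
  fun b => match b return pair_family (richardson C u v) (richardson C v w) b with
    | true => richardson_point (rg F).1
    | false => richardson_point (rg F).2
    end.
have nU : is_swf (subspace U) by apply: swf_subspace.
have regl : regular_mx setT left_coord.
  apply: regular_coord_comp => //; apply: (morphism_comp (@morphism_point _ _ u v)).
  exact: (@morphism_proj _ _ _ true nf).
have regr : regular_mx setT right_coord.
  apply: regular_coord_comp => //; apply: (morphism_comp (@morphism_point _ _ v w)).
  exact: (@morphism_proj _ _ _ false nf).
have regc : regular_mx setT coord.
  apply: regular_coord_comp => //; last by move=> F; apply: (svalP F).
  by apply: (morphism_comp (@morphism_point _ _ u w)); apply: morphism_sval.
exists m; apply: (@open_emb_partial_inverse _ _ _ m U mU r) => //.
- apply: (@morphism_to_richardson _ _ _ _ _ v m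
    (fun p => splice_mul (left_coord p) (right_coord p))) => //.
  exact: regular_splice_mul sc ul ur regl regr.
- have [om _] := @morphism_point C k u w.
  by apply: om; apply: open_flag_chart.
- apply: morphism_to_product => // -[].
    apply: (@morphism_to_richardson _ _ _ _ _ v _ (fun F => splice_left (coord F))) => //.
      exact: regular_splice_left sc ug regc.
    by move=> F; have [] := splice_leftP sc (ug F).
  apply: (@morphism_to_richardson _ _ _ _ _ v _ (fun F => splice_right (coord F))) => //.
    exact: regular_splice_right sc ug regc.
  by move=> F; have [] := splice_rightP sc (ug F).
- move=> p; have cE : coord (exist _ (m p) (mU p)) = splice_mul (left_coord p) (right_coord p).
    by have [] := flag_coord_unipotent (um p).
  have [Kl Kr] := splice_mulK sc (ul p) (ur p) (upl p) (lor p).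
  apply: functional_extensionality_dep => -[]; apply: subspace_eq => /=.
    by rewrite cE Kl; have [_ ->] := flag_coordP (cl p).
  by rewrite cE Kr; have [_ ->] := flag_coordP (cr p).
- move=> F; apply: subspace_eq => /=.
  have [ubl _] := splice_leftP sc (ug F); have [uar _] := splice_rightP sc (ug F).
  rewrite /left_coord /right_coord /=.
  rewrite (flag_coord_unipotent ubl).2 (flag_coord_unipotent uar).2 (spliceK sc (ug F)).
  by have [_ <-] := flag_coordP (svalP F).
Qed.

Definition Gm (C : fieldType) : fspace C := @subspace C (affine_line C) [set x | x != 0].

Lemma swf_Gm (C : fieldType) : is_swf (Gm C).
Proof. exact/swf_subspace/swf_affine_line. Qed.

Lemma regular_Gm (C : fieldType) : @regular C (Gm C) setT sval.
Proof.
have [_ rs] := @morphism_sval C (affine_line C) [set x | x != 0].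
apply: (rs setT id); first exact: swf_openT (swf_affine_line C).
move=> x _; exists setT; exists [set id], id, (fun=> 1); split=> //.
- exact: GenIn.
- exact: GenConst.
- by split=> //; exact: oner_neq0.
- by move=> *; rewrite divr1.
Qed.

(** The coordinate on the curve is the entry (v(j), v(i)) of the chart
    coordinate. *)
Theorem cover_isomorphism (C : fieldType) k (v w : 'S_k) :
  bruhat_cover v w -> exists f : Gm C -> richardson C v w, is_isomorphism f.
Proof.
move=> /bruhat_coverP[i [j [lt_ij lt_v -> gap]]]; set w' := (tperm i j * v)%g.
have nR := @swf_richardson C k v w'; have nG := swf_Gm C.
have rootU (s : C) : unipotent (cell_order v) (root_mx (v j) (v i) s).
  by apply: root_mx_unipotent; rewrite /cell_order /= !permK.
have rootR (s : Gm C) : in_richardson v w' (root_mx (v j) (v i) (sval s) *m permmx C v).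
  split; first exact: root_curve_cell (svalP s).
  by apply: bruhat_cell_self; apply: root_mx_unipotent.
pose f s : richardson C v w' := richardson_point (rootR s).
pose coord (F : richardson C v w') : 'M[C]_k := flag_coord v (sval F).
have chartF (F : richardson C v w') := (richardson_bottom F).1.
have curve (F : richardson C v w') : coord F (v j) (v i) != 0 /\
    coord F = root_mx (v j) (v i) (coord F (v j) (v i)).
  have [ug _] := flag_coordP (chartF F); have [_ lowg] := richardson_bottom F.
  have [cell _] := richardson_coord (chartF F).
  exact: cover_curve lt_ij lt_v gap lowg ug cell.
pose g (F : richardson C v w') : Gm C :=
  exist (fun x : affine_line C => x != 0) _ (curve F).1.
exists f; split.
  apply: (@morphism_to_richardson _ _ _ _ _ v f 
    (fun s : Gm C => root_mx (v j) (v i) (sval s))) => //.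
  move=> a b; under eq_fun do rewrite root_mxE.
  apply: (swf_add nG); first exact: (swf_const nG).
  by apply: (swf_mul nG); [exact: regular_Gm | exact: (swf_const nG)].
exists g; split.
- apply: (@morphism_to_subspace _ _ (affine_line C)) => //.
  apply: morphism_to_affine_line => //; apply: regular_coord_comp => //.
  exact: morphism_point.
- move=> s; apply: subspace_eq => /=.
  rewrite /coord /= (flag_coord_unipotent (rootU _)).2 root_mxE !eqxx mulr1.
  by rewrite (inj_eq perm_inj) -(inj_eq val_inj) gtn_eqF // add0r.
- move=> F; apply: subspace_eq => /=; rewrite -(curve F).2.
  by have [_ <-] := flag_coordP (chartF F).
Qed.

(** The chart coordinate is both upper and lower unitriangular. *)
Lemma richardson_refl (C : fieldType) k (v : 'S_k) (F : richardson C v v) :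
  sval F = flag_of_mx (permmx C v).
Proof.
have [chartF upF] := richardson_top F; have [_ lowF] := richardson_bottom F.
have [_ {1}->] := flag_coordP chartF.
by rewrite (lower_upper_eq1 lowF (unipotent_supported upF)) mul1mx.
Qed.

(** Splicing at v_l joins the embedding for the first l steps to the last
    factor; the induction starts from the single point R(v_0, v_0). *)
Lemma chain_open_emb (C : fieldType) k (v : nat -> 'S_k) (l : nat) :
  exists iota : product_space (fun i : 'I_l => richardson C (v i) (v i.+1)) ->
                richardson C (v 0%N) (v l),
    open_emb iota.
Proof.
have nR i : is_swf (richardson C (v i) (v i.+1)) by apply: swf_richardson.
elim: l => [|l [iota eiota]].
  set P := product_space _; set R := richardson _ _ _.
  have nP : is_swf P by apply: swf_product_space.
  have nR0 : is_swf R by apply: swf_richardson.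
  have rv : in_richardson (v 0%N) (v 0%N) (permmx C (v 0%N)).
    by rewrite -[permmx C _]mul1mx; split; apply/bruhat_cell_self/unipotent1.
  pose F0 : R := richardson_point rv.
  have RE (F : R) : F = F0 by apply: subspace_eq; rewrite richardson_refl.
  have PE (x y : P) : x = y by apply: functional_extensionality_dep => -[].
  pose r (_ : subspace [set: R]) : P :=
    fun i : 'I_0 => False_rect _ (notF (ltn_ord i)).
  exists (fun=> F0).
  apply: (@open_emb_partial_inverse _ P R _ setT (fun=> I) r) => //.
  - split=> [V oV|V h oV rh].
      have [VF|VF] := pselect (V F0).
        rewrite (_ : _ @^-1` V = setT); first exact: swf_openT.
        by apply/seteqP; split.
      rewrite (_ : _ @^-1` V = set0); last by apply/seteqP; split.
      exact: (swf_open_local nP).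
    exact: swf_const.
  - exact: swf_openT.
  - by apply: morphism_to_product => [|[]]; first exact: swf_subspace.
have nP : is_swf (product_space (fun i : 'I_l => richardson C (v i) (v i.+1))).
  exact: swf_product_space.
have nR' : is_swf (richardson C (v 0%N) (v l)) by apply: swf_richardson.
have [f isof] := split_last_isomorphism l nR.
have [m em] := @splice_open_emb C k (v 0%N) (v l) (v l.+1).
have nf := swf_pair_family nP (nR l); have nf' := swf_pair_family nR' (nR l).
pose iota2 b : pair_family (product_space (fun i : 'I_l => richardson C (v i) (v i.+1)))
                           (richardson C (v l) (v l.+1)) b ->
               pair_family (richardson C (v 0%N) (v l)) (richardson C (v l) (v l.+1)) b :=
  match b with true => iota | false => id end.
pose iota' (x : pair_space _ _) : pair_space _ _ := fun b => iota2 b (x b).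
have eiota2 : open_emb iota'.
  by apply: (product_open_emb nf nf') => -[//|]; apply: open_emb_id.
exists (m \o (iota' \o f)).
apply: open_emb_comp em _; apply: open_emb_comp eiota2 _.
by apply: open_emb_iso isof; apply: swf_product_space.
Qed.

Theorem corollary1p6 (R : realType) (k l : nat) (u w : 'S_k) (v : nat -> 'S_k)
    (v_first : v 0%N = u) (v_last : v l = w)
    (v_cover : forall i : nat, (i < l)%N -> bruhat_cover (v i) (v i.+1)) :
  exists (phi : torus R[i] l ->
                product_space (fun i : 'I_l => richardson R[i] (v i) (v i.+1)))
         (iota : product_space (fun i : 'I_l => richardson R[i] (v i) (v i.+1)) ->
                 richardson R[i] u w),
    is_isomorphism phi /\ is_open_embedding iota.
Proof.
subst u w.
have iso (i : 'I_l) : {f : Gm R[i] -> richardson R[i] (v i) (v i.+1) | is_isomorphism f}.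
  by apply/cid/cover_isomorphism/v_cover.
have [iota eiota] := @chain_open_emb R[i] k v l.
exists (fun x i => sval (iso i) (x i)), iota; split.
  apply: (@product_isomorphism _ _ (fun=> Gm R[i]) _ (fun i => sval (iso i))) => i.
  - exact: swf_Gm.
  - exact: swf_richardson.
  - exact: (svalP (iso i)).
apply: open_emb_is_open_embedding eiota; last exact: swf_richardson.
by apply: swf_product_space => i; apply: swf_richardson.
Qed.
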